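(* For any real $\beta>0$ and $\delta>1$ there are $u,v>0$ and $N_0\in\mathbb{N}$ depending only on $\beta$ and $\delta$ with the following property. Let $N,n\in\mathbb{N}$ satisfy $N\ge\max(N_0,\delta n)$, and let $A=(a_{ij})$ be an $N\times n$ random matrix with i.i.d. (real) entries such that for some $\alpha>0$ the concentration function of the entries satisfies $$\mathcal{Q}(a_{11},\alpha)\le 1-\beta.$$ Then for any non-random $N\times n$ (real) matrix $B$ we have $$\mathbb{P}\bigl\{s_n(A+B)\le \alpha u\sqrt{N}\bigr\}\le \exp(-vN).$$
   Context: For a real random variable $\xi$ and $\alpha\ge 0$, the concentration function is $\mathcal{Q}(\xi,\alpha)=\sup_{\lambda\in\mathbb{R}}\mathbb{P}\{|\xi-\lambda|\le\alpha\}$. For a real $N\times n$ matrix $D$ with $N\ge n$, $s_n(D)=\inf_{y\in S^{n-1}}\|Dy\|$ is its smallest singular value, where $\|\cdot\|$ is the Euclidean norm and $S^{n-1}$ is the Euclidean unit sphere of $\mathbb{R}^n$. No moment assumptions are made on the entries. *)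

(* Defs.v *)
(* MathComp / MathComp-Analysis *)
From HB Require Import structures.
From mathcomp Require Import all_boot all_order all_algebra.
From mathcomp Require Import all_classical all_reals all_analysis.

Set Implicit Arguments.
Unset Strict Implicit.
Unset Printing Implicit Defensive.

Import Order.TTheory GRing.Theory Num.Theory.
Import numFieldNormedType.Exports.

Local Open Scope classical_set_scope.
Local Open Scope ring_scope.

(* The canonical norm of matrices in the library is the sup norm, hence a
   separate Euclidean norm. *)
Definition enorm (R : realType) (n : nat) (x : 'cV[R]_n) : R :=
  Num.sqrt (\sum_(i < n) x i 0 ^+ 2).

Definition esphere (R : realType) (n : nat) : set 'cV[R]_n :=
  [set y | enorm y = 1].

(* For n = 0 the sphere is empty and the real infimum takes the default
   value 0. *)
Definition smallest_singular (R : realType) (N n : nat) (D : 'M[R]_(N, n)) : R :=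
  inf [set enorm (D *m y) | y in @esphere R n].

Definition concentration d (T : measurableType d) (R : realType)
    (P : probability T R) (xi : {RV P >-> R}) (alpha : R) : \bar R :=
  ereal_sup [set P [set w | `|xi w - lambda| <= alpha] | lambda in [set: R]].

Definition mutually_independent d (T : measurableType d) (R : realType)
    (P : probability T R) (I : finType) (X : I -> {RV P >-> R}) : Prop :=
  forall (J : {set I}) (E : I -> set R),
    (forall i, measurable (E i)) ->
    P (\bigcap_(i in [set` J]) (X i @^-1` E i)) =
      (\prod_(i in J) P (X i @^-1` E i))%E.

(* The laws are compared on Borel sets only: the values of
   [distribution P X] on other sets carry no meaning. *)
Definition identically_distributed d (T : measurableType d) (R : realType)
    (P : probability T R) (I : Type) (X : I -> {RV P >-> R}) : Prop :=
  forall (i j : I) (E : set R), measurable E ->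
    distribution P (X i) E = distribution P (X j) E.

Definition iid_entries d (T : measurableType d) (R : realType)
    (P : probability T R) (N n : nat) (A : 'I_N -> 'I_n -> {RV P >-> R}) : Prop :=
  let X := fun ij : 'I_N * 'I_n => A ij.1 ij.2 in
  mutually_independent X /\ identically_distributed X.

Definition sample_mx d (T : measurableType d) (R : realType)
    (P : probability T R) (N n : nat) (A : 'I_N -> 'I_n -> {RV P >-> R})
    (w : T) : 'M[R]_(N, n) :=
  \matrix_(i < N, j < n) A i j w.

(* Main.v *)
Require Import Defs.
From HB Require Import structures.
From mathcomp Require Import all_boot all_order all_algebra.
From mathcomp Require Import boolp reals ring lra zify.

Set Implicit Arguments.
Unset Strict Implicit.
Unset Printing Implicit Defensive.

Import Order.TTheory GRing.Theory Num.Theory.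
Local Open Scope ring_scope.

(** Let D be the random matrix plus its deterministic shift.  The entries may
have arbitrarily heavy tails and the shift is arbitrary, so D has no usable
operator norm and nets on the sphere are of no help.  The argument replaces
nets by counting sign patterns: m linear forms on a space of dimension d much
smaller than m realise at most exp(o(m)) sign patterns, whatever the size of
their coefficients ([card_sign_patterns]).  To make this count applicable one
has to reach a situation where far more random rows than parameters remain.

Cut the columns into a bounded number r of blocks.  For every y some block J
carries at least 1/r of the squared norm of y ([heavy_residue_block]), so it is
enough to treat one J and to sum over the blocks.  Freeze the columns outside J
and let E be their span, of codimension at least kappa N with
kappa = 1 - 1/delta.  If D y is small, then the combination of the columns in J
with coefficients y is close to E.

The space E still has too many dimensions for the count.  The lemma
[dimension_reduction] provides a set I of rows, of size proportional to N, and
a bounded linear map M that kills E and that acts on vectors supported by I as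
the identity minus a map of rank at most zeta |I|, with zeta as small as
desired.  Freeze also the entries in J outside I.  Then D y small implies
M (D y) small, and for i in I the coordinate i of M (D y) is a linear form in
at most |J| + zeta |I| parameters whose only random coefficients are the
entries (i, j) with j in J.

It remains to show that, outside an event of probability exp(-c |I|), no choice
of parameters makes almost all of these |I| forms small.  One form is small
with probability at most 1 - beta/48, by symmetrisation and the
Paley-Zygmund inequality ([small_ball]).  The uniform statement follows by the
double-sample argument ([degenerate_prob]): compare with an independent copy of
the rows, exchange the two copies of each row at random, and take a union bound
over the sign patterns.

Conditioning is done throughout on a finite product space, where it amounts to
resampling part of the coordinates ([Ex_resample]).  This loses nothing: the
line is cut into finitely many small cells and a tail of small probability, and
for independent entries of equal law the cells have a product law
([transfer]). *)

(** * Finite product probability spaces *)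

Section FiniteProduct.
Variables (R : realType) (T G : finType) (p : G -> R).
Hypothesis p_ge0 : forall x, 0 <= p x.
Hypothesis p_sum1 : \sum_x p x = 1.

(** [weight], [Ex] and [Pr] are the point masses, the expectation and the
probability for independent coordinates, all of law [p]. *)
Definition weight (f : {ffun T -> G}) : R := \prod_t p (f t).

Definition Ex (phi : {ffun T -> G} -> R) : R := \sum_f weight f * phi f.

Lemma weight_ge0 f : 0 <= weight f.
Proof. by apply: prodr_ge0. Qed.

Lemma Ex_prod (F : T -> G -> R) :
  Ex (fun f => \prod_t F t (f t)) = \prod_t \sum_x p x * F t x.
Proof.
rewrite bigA_distr_bigA /=; apply: eq_bigr => f _.
by rewrite /weight -big_split.
Qed.

Lemma eq_Ex phi psi : phi =1 psi -> Ex phi = Ex psi.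
Proof. by move=> e; apply: eq_bigr => f _; rewrite e. Qed.

Lemma Ex1 : Ex (fun=> 1) = 1.
Proof.
transitivity (Ex (fun f => \prod_(t : T) 1)); first by apply: eq_Ex => f; rewrite big1.
rewrite (Ex_prod (fun _ _ => 1)) big1 // => t _.
by rewrite -[RHS]p_sum1; apply: eq_bigr => x _; rewrite mulr1.
Qed.

Lemma ExZ c phi : Ex (fun f => c * phi f) = c * Ex phi.
Proof. by rewrite /Ex mulr_sumr; apply: eq_bigr => f _; rewrite mulrCA. Qed.

Lemma ExD phi psi : Ex (fun f => phi f + psi f) = Ex phi + Ex psi.
Proof. by rewrite /Ex -big_split; apply: eq_bigr => f _; rewrite mulrDr. Qed.

Lemma Ex_sum (I : Type) (r : seq I) (P : pred I) (F : I -> {ffun T -> G} -> R) :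
  Ex (fun f => \sum_(i <- r | P i) F i f) = \sum_(i <- r | P i) Ex (F i).
Proof.
by rewrite /Ex exchange_big; apply: eq_bigr => f _; rewrite mulr_sumr.
Qed.

Lemma Ex_cst c : Ex (fun=> c) = c.
Proof. by rewrite -[RHS]mulr1 -Ex1 -ExZ; apply: eq_Ex => f; rewrite mulr1. Qed.

Lemma ler_Ex phi psi : (forall f, phi f <= psi f) -> Ex phi <= Ex psi.
Proof.
by move=> le; apply: ler_sum => f _; apply: ler_wpM2l (le f); exact: weight_ge0.
Qed.

Lemma Ex_ge0 phi : (forall f, 0 <= phi f) -> 0 <= Ex phi.
Proof. by move=> h; apply: sumr_ge0 => f _; apply: mulr_ge0 (h f); exact: weight_ge0. Qed.

Lemma Ex_le_cst c phi : (forall f, phi f <= c) -> Ex phi <= c.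
Proof. by move=> h; rewrite -[leRHS]Ex_cst; apply: ler_Ex. Qed.

Lemma Ex_marginal t (F : G -> R) : Ex (fun f => F (f t)) = \sum_x p x * F x.
Proof.
transitivity (Ex (fun f => \prod_s (if s == t then F (f s) else 1))).
  by apply: eq_Ex => f; rewrite -big_mkcond big_pred1_eq.
rewrite (Ex_prod (fun s x => if s == t then F x else 1)) (bigD1 t) //= eqxx.
rewrite [X in _ * X]big1 ?mulr1 // => s /negPf ->.
by rewrite -[RHS]p_sum1; apply: eq_bigr => x _; rewrite mulr1.
Qed.

(** On pairs of independent samples, exchanging the coordinates in [S] preserves
the law.  All conditioning and all symmetrisation below come from this fact. *)
Definition mix (S : pred T) (f g : {ffun T -> G}) : {ffun T -> G} :=
  [ffun t => if S t then g t else f t].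

Lemma mixK S f g : mix S (mix S f g) (mix S g f) = f.
Proof. by apply/ffunP => t; rewrite !ffunE; case: (S t). Qed.

Lemma weight_mix S f g : weight (mix S f g) * weight (mix S g f) = weight f * weight g.
Proof.
rewrite /weight -!big_split; apply: eq_bigr => t _ /=; rewrite !ffunE.
by case: (S t) => //; rewrite mulrC.
Qed.

Lemma Ex_swap S (phi : {ffun T -> G} -> {ffun T -> G} -> R) :
  Ex (fun f => Ex (phi f)) = Ex (fun f => Ex (fun g => phi (mix S f g) (mix S g f))).
Proof.
have E psi : Ex (fun f => Ex (psi f)) =
    \sum_(fg : {ffun T -> G} * {ffun T -> G}) weight fg.1 * weight fg.2 * psi fg.1 fg.2.
  rewrite -(pair_bigA _ (fun f g => weight f * weight g * psi f g)) /=.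
  by apply: eq_bigr => f _; rewrite mulr_sumr; apply: eq_bigr => g _; rewrite mulrA.
pose h (fg : {ffun T -> G} * {ffun T -> G}) := (mix S fg.1 fg.2, mix S fg.2 fg.1).
have hK : involutive h by case=> f g; rewrite /h /= !mixK.
rewrite !E (reindex_inj (inv_inj hK)) /=.
by apply: eq_bigr => -[f g] _ /=; rewrite weight_mix.
Qed.

(** Fubini in the form of a resampling: once [f] is fixed, only the coordinates
in [S] remain random, and [S] may be chosen according to [f]. *)
Lemma Ex_resample S phi : Ex phi = Ex (fun f => Ex (fun g => phi (mix S f g))).
Proof.
rewrite -(Ex_swap S (fun f _ => phi f)); apply: eq_Ex => f.
by rewrite Ex_cst.
Qed.

Definition Pr (A : {ffun T -> G} -> Prop) : R := Ex (fun f => (`[< A f >])%:R).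

Lemma Pr_ge0 A : 0 <= Pr A.
Proof. by apply: Ex_ge0 => f; rewrite ler0n. Qed.

Lemma ler_Pr (A B : {ffun T -> G} -> Prop) : (forall f, A f -> B f) -> Pr A <= Pr B.
Proof.
move=> AB; apply: ler_Ex => f; rewrite ler_nat.
by case: asboolP => // a; case: asboolP => // nb; case: nb; exact: AB.
Qed.

Lemma Pr_exists (I : finType) (A : I -> {ffun T -> G} -> Prop) :
  Pr (fun f => exists i, A i f) <= \sum_i Pr (A i).
Proof.
rewrite /Pr -Ex_sum; apply: ler_Ex => f.
case: asboolP => [[i Ai]|_]; last by apply: sumr_ge0 => i _; rewrite ler0n.
rewrite (bigD1 i) //=; case: asboolP => // _; rewrite lerDl.
by apply: sumr_ge0 => j _; rewrite ler0n.
Qed.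

Lemma PrC (A : {ffun T -> G} -> Prop) : Pr (fun f => ~ A f) = 1 - Pr A.
Proof.
apply/eqP; rewrite eq_sym subr_eq -[X in X == _]Ex1 /Pr -ExD; apply/eqP/eq_Ex => f.
by do 2!case: asboolP => //; rewrite ?addr0 ?add0r //; tauto.
Qed.

Lemma Pr_resample_le S A c :
  (forall f, Pr (fun g => A (mix S f g)) <= c) -> Pr A <= c.
Proof.
move=> h; rewrite /Pr (Ex_resample S).
by apply: Ex_le_cst.
Qed.

End FiniteProduct.

(** * Anticoncentration of one linear form *)

(** Used with random signs on one side: an expectation that is invariant under a
family of exchanges may be averaged over the family. *)
Lemma Ex_exchange (R : realType) (T T' G G' : finType) (p : G -> R) (p' : G' -> R)
    (phi : {ffun T -> G} -> {ffun T' -> G'} -> R) :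
  Ex p (fun f => Ex p' (phi f)) = Ex p' (fun g => Ex p (phi^~ g)).
Proof.
rewrite /Ex; under eq_bigr do rewrite mulr_sumr.
rewrite exchange_big; apply: eq_bigr => g _; rewrite mulr_sumr.
by apply: eq_bigr => f _; rewrite mulrCA.
Qed.

Section Rademacher.
Variables (R : realType) (T : finType).

(** [Ex coin] averages over all sign vectors; the value [true] at [t] encodes the
sign -1. *)
Definition coin (_ : bool) : R := 2^-1.

Lemma coin_ge0 x : 0 <= coin x. Proof. by rewrite /coin; lra. Qed.

Lemma coin_sum1 : \sum_x coin x = 1.
Proof. by rewrite big_bool /coin /=; lra. Qed.

Let flip (t : T) (e : {ffun T -> bool}) : {ffun T -> bool} :=
  [ffun s => if s == t then ~~ e s else e s].

Lemma Ex_flip t phi : Ex coin phi = Ex coin (fun e => phi (flip t e)).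
Proof.
have fK : involutive (flip t).
  by move=> e; apply/ffunP => s; rewrite !ffunE; case: eqP => //; rewrite negbK.
by rewrite /Ex (reindex_inj (inv_inj fK)); apply: eq_bigr => e _.
Qed.

Variable b : T -> R.

Definition signsum (s : seq T) (e : {ffun T -> bool}) : R :=
  \sum_(t <- s) (-1) ^+ (e t) * b t.

Lemma signsum_flip t s e : t \notin s -> signsum s (flip t e) = signsum s e.
Proof.
move=> ts; apply: eq_big_seq => s' s's; rewrite ffunE.
by case: eqP => // ee; rewrite -ee s's in ts.
Qed.

(** Flipping the sign at [t] preserves the law, so the new term enters every
moment only through the average of its two values. *)
Lemma signsum_moment_cons (phi : R -> R) t s : t \notin s ->
  Ex coin (fun e => phi (signsum (t :: s) e)) =
  Ex coin (fun e => (phi (signsum s e + b t) + phi (signsum s e - b t)) / 2).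
Proof.
move=> ts; have {1}-> : Ex coin (fun e => phi (signsum (t :: s) e)) =
    Ex coin (fun e => 2^-1 * (phi (signsum (t :: s) e) + phi (signsum (t :: s) (flip t e)))).
  by rewrite ExZ ExD -(Ex_flip t (fun e => phi (signsum (t :: s) e))); lra.
apply: eq_Ex => e; rewrite mulrC; congr (_ / _).
rewrite /signsum !big_cons -!/(signsum _ _) signsum_flip // ffunE eqxx.
set S := signsum s e.
case: (e t); rewrite /= ?expr1 ?expr0 ?mulN1r ?mul1r.
  by rewrite addrC; congr (phi _ + phi _); ring.
by congr (phi _ + phi _); ring.
Qed.

Lemma signsum_moment2 s : uniq s ->
  Ex coin (fun e => signsum s e ^+ 2) = \sum_(t <- s) b t ^+ 2.
Proof.
elim: s => [|t s IH] /=.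
  by move=> _; rewrite big_nil -[RHS](Ex_cst T coin_sum1); apply: eq_Ex => e;
    rewrite /signsum big_nil expr0n.
case/andP => ts /IH {}IH.
rewrite (signsum_moment_cons (fun x => x ^+ 2)) // big_cons -IH addrC.
rewrite -[X in _ = _ + X](Ex_cst T coin_sum1) -ExD.
by apply: eq_Ex => e; field.
Qed.

Lemma signsum_moment4 s : uniq s ->
  Ex coin (fun e => signsum s e ^+ 4) <= 3 * (\sum_(t <- s) b t ^+ 2) ^+ 2.
Proof.
elim: s => [|t s IH] /=.
  move=> _; rewrite big_nil (_ : Ex coin _ = 0) ?expr0n ?mulr0 //.
  by rewrite -[RHS](Ex_cst T coin_sum1); apply: eq_Ex => e; rewrite /signsum big_nil expr0n.
case/andP => ts us; have {}IH := IH us.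
rewrite (signsum_moment_cons (fun x => x ^+ 4)) // big_cons.
rewrite (_ : Ex coin _ = Ex coin (fun e => signsum s e ^+ 4)
   + (6 * b t ^+ 2) * Ex coin (fun e => signsum s e ^+ 2) + b t ^+ 4); last first.
  rewrite -[X in _ = _ + X](Ex_cst T coin_sum1) -ExZ -!ExD.
  by apply: eq_Ex => e; field.
rewrite signsum_moment2 //.
set A := \sum_(_ <- _) _ in IH *; set x := Ex _ _ in IH *.
have : 0 <= b t ^+ 4 by rewrite (exprM _ 2 2) sqr_ge0.
have -> : b t ^+ 4 = b t ^+ 2 * b t ^+ 2 by ring.
by nra.
Qed.

(** Let q be the square of the sum, normalised to have mean 1; then q^2 has mean
at most 3.  The pointwise bound q/3 - q^2/18 - 1/12 <= 1 when q > 1/4, with a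
nonpositive left side otherwise, gives 1/3 - 3/18 - 1/12 = 1/12 in the mean. *)
Lemma rademacher_paley_zygmund : 0 < \sum_t b t ^+ 2 ->
  1 / 12 <= Ex coin (fun e => ((\sum_t b t ^+ 2) / 4 <
     (\sum_t (-1) ^+ (e t) * b t) ^+ 2)%R%:R).
Proof.
set A := \sum_t _ => A0.
pose X e := signsum (index_enum T) e.
have m2 : Ex coin (fun e => X e ^+ 2) = A by apply: signsum_moment2; exact: index_enum_uniq.
have m4 : Ex coin (fun e => X e ^+ 4) <= 3 * A ^+ 2.
  by apply: signsum_moment4; exact: index_enum_uniq.
set E := Ex coin _.
have : 12 * A * A - 2 * (3 * A ^+ 2) - 3 * A ^+ 2 <= 36 * A ^+ 2 * E.
  apply: le_trans (_ : Ex coin (fun e => (12 * A) * X e ^+ 2 + - 2 * X e ^+ 4 + - 3 * A ^+ 2) <= _).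
    by rewrite !ExD !ExZ (Ex_cst T coin_sum1) m2; lra.
  rewrite -ExZ; apply: (ler_Ex coin_ge0) => e; rewrite -/(signsum (index_enum T) e) -/(X e).
  rewrite (_ : X e ^+ 4 = X e ^+ 2 * X e ^+ 2); last by ring.
  have := sqr_ge0 (X e); set q := X e ^+ 2 => q0.
  case: ltP => /= h; nra.
have : 0 < A ^+ 2 by rewrite exprn_gt0.
by set AA := A ^+ 2; rewrite (_ : 12 * A * A = 12 * AA) /AA; [nra | ring].
Qed.

End Rademacher.

Section SmallBall.
Variables (R : realType) (T G : finType) (p val : G -> R) (beta : R).
Hypothesis p_ge0 : forall x, 0 <= p x.
Hypothesis p_sum1 : \sum_x p x = 1.
Hypothesis beta_gt0 : 0 < beta.
Hypothesis conc : forall la, \sum_(x | `|val x - la| <= 1) p x <= 1 - beta.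

Variable z : T -> R.
Hypothesis z_neq0 : 0 < \sum_t z t ^+ 2.

Let X (f : {ffun T -> G}) := \sum_t val (f t) * z t.
Let V := \sum_t z t ^+ 2.

Let far (f g : {ffun T -> G}) t : R := (1 < `|val (f t) - val (g t)|)%R%:R.

(** Given the first copy at [t], the second one avoids the interval of radius 1
around it with probability at least [beta]. *)
Let diff_large t :
  beta <= Ex p (fun f => Ex p (fun g => far f g t)).
Proof.
have -> : Ex p (fun f => Ex p (fun g => far f g t)) =
   \sum_x p x * \sum_y p y * (1 < `|val x - val y|)%R%:R.
  rewrite -(Ex_marginal p_sum1 t (fun x => \sum_y p y * (1 < `|val x - val y|)%R%:R)).
  apply: eq_Ex => f.
  by rewrite -(Ex_marginal p_sum1 t (fun y => (1 < `|val (f t) - val y|)%R%:R)).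
rewrite -[leLHS]mul1r -{1}p_sum1 mulr_suml; apply: ler_sum => x _.
apply: ler_wpM2l => //.
have := conc (val x).
have : 1 = \sum_(y | `|val y - val x| <= 1) p y + \sum_(y | ~~ (`|val y - val x| <= 1)) p y.
  by rewrite -[LHS]p_sum1 (bigID (fun y => `|val y - val x| <= 1) predT).
suff -> : \sum_y p y * (1 < `|val x - val y|)%R%:R =
   \sum_(y | ~~ (`|val y - val x| <= 1)) p y by lra.
rewrite [RHS]big_mkcond /=; apply: eq_bigr => y _.
by rewrite -ltNge distrC; case: ltP; rewrite ?mulr1 ?mulr0.
Qed.

(** Exchange the two copies at random: the difference becomes a Rademacher sum
with coefficients [(val (f t) - val (g t)) * z t].  The part [om] of its variance
due to the coordinates where the copies are far apart has mean at least
[beta * V] and never exceeds [V], so it is at least [beta / 2 * V] with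
probability at least [beta / 2]; then Paley-Zygmund applies. *)
Let pair_anticoncentration :
  beta / 24 <= Ex p (fun f => Ex p (fun g => (beta / 8 * V < (X f - X g) ^+ 2)%R%:R)).
Proof.
set D := Ex p _.
have -> : D = Ex (coin R) (fun e : {ffun T -> bool} => D).
  by rewrite (Ex_cst T (coin_sum1 R)).
under eq_Ex => e do rewrite /D (Ex_swap _ (fun t => e t)).
rewrite Ex_exchange; under eq_Ex => f do rewrite Ex_exchange.
pose om (f g : {ffun T -> G}) := \sum_t z t ^+ 2 * far f g t.
apply: le_trans
  (_ : Ex p (fun f => Ex p (fun g => (12 * V)^-1 * (om f g + - (beta / 2 * V)))) <= _).
  under eq_Ex => f do rewrite ExZ ExD (Ex_cst T p_sum1).
  rewrite ExZ ExD (Ex_cst T p_sum1).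
  have -> : Ex p (fun f => Ex p (om f)) = \sum_t z t ^+ 2 *
     Ex p (fun f => Ex p (fun g => far f g t)).
    rewrite /om; under eq_Ex => f do rewrite Ex_sum.
    rewrite Ex_sum; apply: eq_bigr => t _.
    by under eq_Ex => f do rewrite ExZ; rewrite ExZ.
  have : V * beta <= \sum_t z t ^+ 2 *
     Ex p (fun f => Ex p (fun g => far f g t)).
    rewrite /V mulr_suml; apply: ler_sum => t _; apply: ler_wpM2l; first exact: sqr_ge0.
    exact: diff_large.
  move=> h; rewrite [leRHS]mulrC ler_pdivlMr ?mulr_gt0 //.
  by set Y := \sum_t _ in h *; lra.
apply: (ler_Ex p_ge0) => f; apply: (ler_Ex p_ge0) => g.
have E (e : {ffun T -> bool}) : X (mix (fun t => e t) f g) - X (mix (fun t => e t) g f) =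
    \sum_t (-1) ^+ (e t) * ((val (f t) - val (g t)) * z t).
  rewrite /X -sumrB; apply: eq_bigr => t _; rewrite !ffunE.
  by case: (e t); rewrite /= ?expr1 ?expr0; ring.
under eq_Ex => e do rewrite E.
have omV : om f g <= V.
  by apply: ler_sum => t _; rewrite ler_piMr ?sqr_ge0 // lern1 leq_b1.
have om_le : om f g <= \sum_t ((val (f t) - val (g t)) * z t) ^+ 2.
  apply: ler_sum => t _; rewrite /far exprMn mulrC ler_wpM2r ?sqr_ge0 //.
  case: ltP => h /=; last exact: sqr_ge0.
  by rewrite -real_normK ?num_real // exprn_ege1 // ltW.
have V0 : 0 < V by [].
have b2 : 0 <= beta / 2 by rewrite divr_ge0 // ltW.
have [h|h] := leP (om f g) (beta / 2 * V).
  apply: (@le_trans _ _ 0); last by apply: (Ex_ge0 (coin_ge0 R)) => e; rewrite ler0n.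
  by apply: mulr_ge0_le0; [rewrite invr_ge0; lra | lra].
have P : 0 < \sum_t ((val (f t) - val (g t)) * z t) ^+ 2.
  by apply: lt_le_trans om_le; apply: le_lt_trans h; apply: mulr_ge0 b2 (ltW V0).
apply: (@le_trans _ _ (1 / 12)).
  rewrite [leLHS]mulrC ler_pdivrMr; last lra.
  rewrite (_ : 1 / 12 * (12 * V) = V); last by field.
  by have : 0 <= beta / 2 * V by [exact: mulr_ge0 b2 (ltW V0)]; lra.
apply: le_trans (rademacher_paley_zygmund P) _.
apply: (ler_Ex (coin_ge0 R)) => e; rewrite ler_nat.
case: ltP => // h1; rewrite (lt_le_trans _ (ltW h1)) //.
by apply: lt_le_trans (_ : om f g / 4 <= _); lra.
Qed.

(** If X is close to [la] with probability Q, two independent copies are close to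
each other with probability at least Q^2; hence Q^2 <= 1 - beta/24. *)
Lemma small_ball la :
  beta / 48 <= Pr p (fun f : {ffun T -> G} =>
    beta / 32 * (\sum_t z t ^+ 2) < ((\sum_t val (f t) * z t) - la) ^+ 2).
Proof.
rewrite -/V; set Q := Pr _ _.
pose I (f : {ffun T -> G}) : R := (~~ (beta / 32 * V < (X f - la) ^+ 2)%R)%:R.
have EI : Ex p I = 1 - Q.
  rewrite /Q -PrC // /Pr; apply: eq_Ex => f; rewrite /I.
  by case: asboolP => h; [case: ltP h | case: ltP h].
have I1 : 1 - Q <= 1 by rewrite lerBlDr lerDl; exact: Pr_ge0.
have I0 : 0 <= 1 - Q by rewrite -EI; apply: (Ex_ge0 p_ge0) => f; rewrite ler0n.
suff : (1 - Q) * (1 - Q) <= 1 - beta / 24 by nra.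
rewrite -{1}EI -EI -[leLHS]mulrC -ExZ.
under eq_Ex => f do rewrite mulrC -ExZ.
apply: le_trans
  (_ : 1 - Ex p (fun f => Ex p (fun g => (beta / 8 * V < (X f - X g) ^+ 2)%R%:R)) <= _);
  last by have := pair_anticoncentration; lra.
rewrite lerBrDr -ExD -[leRHS](Ex_cst T p_sum1); apply: (ler_Ex p_ge0) => f.
rewrite -ExD -[leRHS](Ex_cst T p_sum1); apply: (ler_Ex p_ge0) => g.
rewrite /I; have [h1|h1] := ltP _ ((X f - la) ^+ 2).
  by rewrite /= mul0r add0r lern1 leq_b1.
have [h2|h2] := ltP _ ((X g - la) ^+ 2).
  by rewrite /= mulr0 add0r lern1 leq_b1.
rewrite /= mulr1; case: ltP => h3 /=; last by rewrite addr0.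
suff : 0 <= (X f - la + (X g - la)) ^+ 2 by nra.
exact: sqr_ge0.
Qed.

End SmallBall.

(** * Shattering and sign patterns of linear forms *)

Section Shattering.
Variable T : finType.

Definition shatters (F : {set {set T}}) (A : {set T}) : bool :=
  [forall B : {set T}, (B \subset A) ==> [exists C in F, C :&: A == B]].

Lemma shattersP (F : {set {set T}}) (A : {set T}) :
  reflect (forall B : {set T}, B \subset A -> exists2 C, C \in F & C :&: A = B)
    (shatters F A).
Proof.
apply: (iffP forallP) => [h B BA|h B].
  by have /implyP/(_ BA)/exists_inP[C CF /eqP e] := h B; exists C.
by apply/implyP => /h [C CF e]; apply/exists_inP; exists C => //; apply/eqP.
Qed.

Lemma shattersS (F F' : {set {set T}}) (A : {set T}) :
  F \subset F' -> shatters F A -> shatters F' A.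
Proof.
move=> /subsetP FF' /shattersP h; apply/shattersP => B /h [C CF e].
by exists C => //; exact: FF'.
Qed.

(** Pajor's form of the Sauer-Shelah lemma.  Split the family by a point [x] that
separates it.  A set shattered by one half avoids [x], and a set shattered by
both halves stays shattered by the whole family after [x] is added, so the
numbers of shattered sets of the two halves add up. *)
Lemma pajor (F : {set {set T}}) : (#|F| <= #|[set A | shatters F A]|)%N.
Proof.
have [n] := ubnP #|F|; elim: n F => // n IH F Fn.
have [F1|F1] := leqP #|F| 1.
  have [->|/set0Pn [C CF]] := eqVneq F set0; first by rewrite cards0.
  apply: leq_trans F1 _; rewrite card_gt0; apply/set0Pn; exists set0.
  rewrite inE; apply/shattersP => B; rewrite subset0 => /eqP ->.
  by exists C => //; rewrite setI0.
have [x [C0 [C1 [C0F C1F xC0 xC1]]]] : exists x C0 C1,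
    [/\ C0 \in F, C1 \in F, x \notin C0 & x \in C1].
  have /card_gt1P [C [C' [CF C'F]]] := F1.
  rewrite eqEsubset negb_and => /orP [] /subsetPn [x h1 h2].
    by exists x, C', C.
  by exists x, C, C'.
pose X := [set C : {set T} | x \in C].
pose Fp := F :&: X; pose Fm := F :\: X.
have cF : #|F| = (#|Fp| + #|Fm|)%N by rewrite cardsID.
have cp : (0 < #|Fp|)%N by apply/card_gt0P; exists C1; rewrite !inE C1F.
have cm : (0 < #|Fm|)%N by apply/card_gt0P; exists C0; rewrite !inE C0F andbT.
have hp : (#|Fp| <= #|[set A | shatters Fp A]|)%N by apply: IH; lia.
have hm : (#|Fm| <= #|[set A | shatters Fm A]|)%N by apply: IH; lia.
set Sp := [set A | shatters Fp A] in hp; set Sm := [set A | shatters Fm A] in hm.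
have xSp (A : {set T}) : A \in Sp -> x \notin A.
  rewrite inE => /shattersP h; apply/negP => xA.
  have [C] := h set0 (sub0set _); rewrite !inE => /andP[_ xC] /setP/(_ x).
  by rewrite !inE xC xA.
have xSm (A : {set T}) : A \in Sm -> x \notin A.
  rewrite inE => /shattersP h; apply/negP => xA.
  have [C] := h A (subxx _); rewrite !inE => /andP[xC _] /setP/(_ x).
  by rewrite !inE (negPf xC) xA.
pose S2 := [set x |: A | A in Sp :&: Sm].
have cS2 : #|S2| = #|Sp :&: Sm|.
  apply: card_in_imset => A B; rewrite inE => /andP[/xSp xA _].
  rewrite inE => /andP[/xSp xB _] /(congr1 (fun A => A :\ x)).
  by rewrite !setU1K.
have dis : (Sp :|: Sm) :&: S2 = set0.
  apply/setP => A; rewrite !inE; apply/negP => /andP[].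
  move=> AS /imsetP [B _ e]; have : x \in A by rewrite e setU11.
  case/orP: AS => h; first by have := xSp A; rewrite inE => /(_ h)/negPf ->.
  by have := xSm A; rewrite inE => /(_ h)/negPf ->.
rewrite cF; apply: leq_trans (leq_add hp hm) _.
rewrite -cardsUI -cS2 -cardsUI dis cards0 addn0; apply: subset_leq_card.
apply/subsetP => A; rewrite !inE -orbA => /or3P [].
- by apply: shattersS; exact: subsetIl.
- by apply: shattersS; exact: subsetDl.
case/imsetP => A'; rewrite !inE => /andP[hp' hm'] ->.
have xA' : x \notin A' by apply: xSp; rewrite inE.
move/shattersP in hp'; move/shattersP in hm'.
apply/shattersP => B BA.
have [xB|xB] := boolP (x \in B).
  have [|C] := hp' (B :\ x).
    apply/subsetP => y; rewrite !inE => /andP[yx yB].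
    by have := subsetP BA y yB; rewrite !inE (negPf yx).
  rewrite !inE => /andP[CF xC] e; exists C => //; apply/setP => y.
  have [->|yx] := eqVneq y x; first by rewrite !inE xC eqxx xB.
  by have /setP/(_ y) := e; rewrite !inE (negPf yx).
have [|C] := hm' B.
  apply/subsetP => y yB; have := subsetP BA y yB; rewrite !inE.
  by case: eqVneq => // yx; rewrite -yx yB in xB.
rewrite !inE => /andP[xC CF] e; exists C => //; apply/setP => y.
have [->|yx] := eqVneq y x; first by rewrite !inE (negPf xC) (negPf xB).
by have /setP/(_ y) := e; rewrite !inE (negPf yx).
Qed.

(** Chernoff's bound: every set counted satisfies 1 <= x^(|A| - D), and the
generating function of the subsets of [Gd] is (1 + x)^|Gd|. *)
Lemma card_small_subsets (R : realType) (x : R) (Gd : {set T}) D : 0 < x <= 1 ->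
  #|[set A : {set T} | (A \subset Gd) && (#|A| <= D)%N]|%:R <= x ^- D * (1 + x) ^+ #|Gd|.
Proof.
case/andP => x0 x1; rewrite mulrC ler_pdivlMr ?exprn_gt0 //.
have -> : (1 + x) ^+ #|Gd| = \sum_(A : {set T}) \prod_t (if t \in A then x * (t \in Gd)%:R else 1).
  rewrite -(@bigA_distr R 0 1 *%R +%R T (fun t => x * (t \in Gd)%:R) (fun=> 1)).
  rewrite (bigID (mem Gd)) /= [X in _ = _ * X]big1 => [|t /negPf ->]; last by rewrite mulr0 add0r.
  rewrite mulr1 -prodr_const; apply: eq_bigr => t ->.
  by rewrite mulr1 addrC.
rewrite -sum1_card natr_sum mulr_suml big_mkcond; apply: ler_sum => A _.
rewrite inE; case: ifP => [/andP[AG AD]|_]; last first.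
  by apply: prodr_ge0 => t _; case: ifP => // _; apply: mulr_ge0; rewrite ?ler0n // ltW.
rewrite mul1r -big_mkcond /= (eq_bigr (fun=> x)); last first.
  by move=> t /(subsetP AG) ->; rewrite mulr1.
by rewrite prodr_const; apply: ler_wiXn2l; rewrite // ltW.
Qed.

End Shattering.

Section SignPatterns.
Variables (R : realType) (T : finType) (D : nat) (phi : T -> 'rV[R]_D) (Gd : {set T}).

Definition sign_pattern (th : 'cV[R]_D) : {set T} :=
  [set t in Gd | 0 < (phi t *m th) 0 0].

Definition sign_patterns : {set {set T}} := [set C | `[< exists th, C = sign_pattern th >]].

Lemma sign_pattern_in th : sign_pattern th \in sign_patterns.
Proof. by rewrite inE; apply/asboolP; exists th. Qed.

(** More than [D] forms satisfy a linear relation with some coefficient positive.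
The pattern in which exactly the forms with positive coefficient are positive
would make that relation a positive number, so it is not realised. *)
Lemma shattered_sign_patterns (A : {set T}) :
  shatters sign_patterns A -> (A \subset Gd) && (#|A| <= D)%N.
Proof.
move=> /shattersP h; apply/andP; split.
  have [C] := h A (subxx _); rewrite inE => /asboolP [th ->] <-.
  by apply/subsetP => t; rewrite !inE => /andP[/andP[]].
rewrite leqNgt; apply/negP => AD.
pose M : 'M[R]_(#|A|, D) := \matrix_(i, j) phi (enum_val i) 0 j.
have : kermx M != 0.
  rewrite kermx_eq0 /row_free neq_ltn; apply/orP; left.
  exact: leq_ltn_trans (rank_leq_col M) AD.
move=> /matrix0Pn [i0 [j0 c0]].
pose c : 'rV[R]_#|A| := row i0 (kermx M).
have cM : c *m M = 0 by rewrite -row_mul mulmx_ker row0.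
have {}c0 : c 0 j0 != 0 by rewrite /c mxE.
clearbody c.
have main (d : 'rV[R]_#|A|) : d *m M = 0 -> d 0 j0 > 0 -> False.
  move=> dM dj0.
  pose B := [set enum_val i | i in [pred i | 0 < d 0 i]].
  have [|C] := h B; first by apply/subsetP => t /imsetP [i _ ->]; exact: enum_valP.
  rewrite inE => /asboolP [th Cth] CAB.
  have Z : \sum_i d 0 i * (phi (enum_val i) *m th) 0 0 = 0.
    transitivity ((d *m M *m th) 0 0); last by rewrite dM mul0mx mxE.
    rewrite -mulmxA mxE; apply: eq_bigr => i _; congr (_ * _).
    by rewrite !mxE; apply: eq_bigr => j _; rewrite mxE.
  have S i : (0 < (phi (enum_val i) *m th) 0 0) = (0 < d 0 i).
    have /setP/(_ (enum_val i)) := CAB; rewrite inE enum_valP andbT.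
    have [C' C'F C'A] := h A (subxx _).
    have eG : enum_val i \in Gd.
      move: C'F; rewrite inE => /asboolP [th' e'].
      have : enum_val i \in C' :&: A by rewrite C'A enum_valP.
      by rewrite e' !inE => /andP[/andP[]].
    rewrite Cth inE eG /= => ->; apply/imsetP/idP => [[i' i'd /enum_val_inj ->]|di] //.
    by exists i.
  have : 0 < \sum_i d 0 i * (phi (enum_val i) *m th) 0 0.
    rewrite (bigD1 j0) //= ltr_pwDl //; first by rewrite mulr_gt0 // S.
    apply: sumr_ge0 => i _; case: (ltP 0 (d 0 i)) (S i) => di Si.
      by apply: mulr_ge0; rewrite ltW // Si.
    by apply: mulr_le0 => //; rewrite leNgt Si.
  by rewrite Z ltxx.
have [c1|c1] := ltP 0 (c 0 j0); first exact: main c cM c1.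
apply: (main (- c)); first by rewrite mulNmx cM oppr0.
by rewrite mxE oppr_gt0 lt_neqAle c0.
Qed.

Lemma card_sign_patterns (x : R) : 0 < x <= 1 ->
  #|sign_patterns|%:R <= x ^- D * (1 + x) ^+ #|Gd|.
Proof.
move=> x01; apply: le_trans (card_small_subsets Gd D x01).
rewrite ler_nat; apply: leq_trans (pajor _) _; apply: subset_leq_card.
by apply/subsetP => A; rewrite !inE; exact: shattered_sign_patterns.
Qed.

End SignPatterns.

(** * Anticoncentration uniform over a low-dimensional family *)

(** The forms studied here have the coefficients [val (g (i, j)) + b i j] for [j]
in [J], and are shifted by an arbitrary point of the range of [U]. *)
Section GhostSample.
Variables (R : realType) (G : finType) (p val : G -> R) (beta : R).
Hypothesis p_ge0 : forall x, 0 <= p x.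
Hypothesis p_sum1 : \sum_x p x = 1.
Hypothesis beta_gt0 : 0 < beta.
Hypothesis conc : forall la, \sum_(x | `|val x - la| <= 1) p x <= 1 - beta.

Variables (N n k : nat) (I : {set 'I_N}) (J : {set 'I_n}).
Variables (b : 'M[R]_(N, n)) (U : 'M[R]_(N, k)).

Let sample := {ffun 'I_N * 'I_n -> G}.

Definition mass (z : 'cV[R]_n) : R := \sum_(j in J) z j 0 ^+ 2.

Definition residual (g : sample) (i : 'I_N) (z : 'cV[R]_n) (a : 'cV[R]_k) : R :=
  \sum_(j in J) (val (g (i, j)) + b i j) * z j 0 + (U *m a) i 0.

Definition large_rows g z a : {set 'I_N} :=
  [set i in I | beta / 32 * mass z < residual g i z a ^+ 2].

Lemma large_row_prob i z a : i \in I -> 0 < mass z ->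
  beta / 48 <= Pr p (fun g => i \in large_rows g z a).
Proof.
move=> iI z0.
pose zz (t : 'I_N * 'I_n) := if (t.1 == i) && (t.2 \in J) then z t.2 0 else 0.
have sumzz (F : 'I_N * 'I_n -> R -> R) : (forall t, F t 0 = 0) ->
    \sum_t F t (zz t) = \sum_(j in J) F (i, j) (z j 0).
  move=> F0; rewrite (eq_bigr (fun t => F (t.1, t.2) (zz (t.1, t.2)))); last by case.
  rewrite -(pair_bigA _ (fun i j => F (i, j) (zz (i, j)))) (bigD1 i) //=.
  rewrite [X in _ + X]big1 ?addr0 => [|i' /negPf ni]; last first.
    by apply: big1 => j _; rewrite /zz /= ni.
  rewrite [RHS]big_mkcond; apply: eq_bigr => j _.
  by rewrite /zz /= eqxx /=; case: ifP.
have m2 : \sum_t zz t ^+ 2 = mass z by rewrite (sumzz (fun _ x => x ^+ 2)) // => t; rewrite expr0n.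
have := @small_ball _ _ _ p val beta p_ge0 p_sum1 beta_gt0 conc zz.
rewrite m2 => /(_ z0 (- (\sum_(j in J) b i j * z j 0 + (U *m a) i 0))) h.
apply: le_trans h _; apply: ler_Pr => // g.
rewrite inE iI /= (sumzz (fun t x => val (g t) * x)) => [h|t]; last exact: mulr0.
move: h; rewrite /residual; congr (_ < _ ^+ 2).
rewrite opprK addrA -big_split /=; congr (_ + _).
by apply: eq_bigr => j _; rewrite mulrDl.
Qed.

Variables (A B : nat).
Hypothesis B_le : B%:R <= beta / 96 * #|I|%:R.

(** A reverse Markov inequality: the mean number of large rows is at least
[beta / 48 * #|I|] and the number never exceeds [#|I|]. *)
Lemma ghost_prob z a : 0 < #|I|%:R :> R -> 0 < mass z ->
  beta / 96 <= Pr p (fun g => (B <= #|large_rows g z a|)%N).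
Proof.
move=> I0 z0; set Q : R := Pr _ _.
suff : beta / 48 * #|I|%:R <= #|I|%:R * Q + B%:R.
  by move: I0 B_le => /=; move: (#|I|%:R : R) (B%:R : R) => x y; nra.
apply: (@le_trans _ _ (\sum_(i in I) Pr p (fun g => i \in large_rows g z a))).
  rewrite mulr_natr -sumr_const; apply: ler_sum => i iI.
  exact: large_row_prob.
rewrite /Q /Pr -Ex_sum -ExZ -[X in _ + X](Ex_cst ('I_N * 'I_n)%type p_sum1) -ExD.
apply: (ler_Ex p_ge0) => g.
have -> : \sum_(i in I) (`[< i \in large_rows g z a >])%:R = #|large_rows g z a|%:R :> R.
  rewrite -sum1_card natr_sum big_mkcond [RHS]big_mkcond; apply: eq_bigr => i _.
  rewrite asboolb; case: ifP => [_|]; first by case: (_ \in _).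
  by case: ifP => // h iI; move: h; rewrite inE iI.
case: asboolP => /= h.
  rewrite mulr1 -natrD ler_nat; apply: leq_trans (leq_addr _ _).
  by apply: subset_leq_card; apply/subsetP => i; rewrite inE => /andP[].
by rewrite mulr0 add0r ler_nat ltnW // ltnNge; apply/negP.
Qed.

Definition degenerate (g : sample) : Prop :=
  exists z a, 0 < mass z /\ (#|large_rows g z a| <= A)%N.

Let separated (g g' : sample) : Prop :=
  exists z a, [/\ 0 < mass z, (#|large_rows g z a| <= A)%N & (B <= #|large_rows g' z a|)%N].

(** For a degenerate sample pick the witness (z, a); an independent second sample
has many large rows for this same witness with probability at least
[beta / 96]. *)
Let symmetrization : 0 < #|I|%:R :> R ->
  beta / 96 * Pr p degenerate <= Ex p (fun g => Pr p (separated g)).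
Proof.
move=> I0; rewrite /Pr -ExZ; apply: (ler_Ex p_ge0) => g.
case: asboolP => [[z [a [z0 za]]]|_]; last by rewrite mulr0; exact: Pr_ge0.
rewrite mulr1; apply: le_trans (ghost_prob a I0 z0) _.
by apply: ler_Pr => // g' h; exists z, a.
Qed.

(** For two fixed samples, whether row [i] of either sample is large is read off
the signs of two linear forms in (z, a, s), where s stands for the threshold
[sqrt (beta / 32 * mass z)]: a residual is large when it or its opposite exceeds
s.  This gives 4 |I| forms in |J| + k + 1 unknowns. *)
Section Patterns.
Variables g g' : sample.

(* In an index (i, (c, e)), c selects the sample and e the sign of the residual. *)
Let two (c : bool) := if c then g' else g.

Let phi (t : 'I_N * (bool * bool)) : 'rV[R]_(#|J| + (k + 1)) :=
  row_mx (\row_j ((-1) ^+ t.2.2 * (val (two t.2.1 (t.1, enum_val j)) + b t.1 (enum_val j))))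
   (row_mx ((-1) ^+ t.2.2 *: row t.1 U) (const_mx (- 1))).

Let theta (z : 'cV[R]_n) (a : 'cV[R]_k) : 'cV[R]_(#|J| + (k + 1)) :=
  col_mx (\col_j z (enum_val j) 0) (col_mx a (const_mx (Num.sqrt (beta / 32 * mass z)))).

Let Gd : {set 'I_N * (bool * bool)} := setX I setT.

Let phi_theta t z a : (phi t *m theta z a) 0 0 =
  (-1) ^+ t.2.2 * residual (two t.2.1) t.1 z a - Num.sqrt (beta / 32 * mass z).
Proof.
rewrite !mul_row_col mxE [X in _ + X]mxE mulrDr addrA; congr (_ + _ + _).
- rewrite (big_enum_val _) /= mxE mulr_sumr; apply: eq_bigr => j _.
  by rewrite !mxE mulrA.
- by rewrite -scalemxAl mxE -row_mul mxE.
- by rewrite mxE big_ord1 !mxE mulN1r.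
Qed.

Let big (C : {set 'I_N * (bool * bool)}) (c : bool) (i : 'I_N) :=
  ((i, (c, false)) \in C) || ((i, (c, true)) \in C).

Let big_pattern z a c i : i \in I ->
  (i \in large_rows (two c) z a) = big (sign_pattern phi Gd (theta z a)) c i.
Proof.
move=> iI; rewrite inE iI /big !inE iI !phi_theta /= expr0 expr1 mul1r mulN1r !subr_gt0.
set r := residual _ _ _ _.
have s0 := sqrtr_ge0 (beta / 32 * mass z).
have m0 : 0 <= beta / 32 * mass z.
  by rewrite mulr_ge0 ?sumr_ge0 // => [|j _]; [rewrite divr_ge0 // ltW | exact: sqr_ge0].
rewrite -{1}(sqr_sqrtr m0) -(real_normK (num_real r)) ltr_sqr ?nnegrE //.
by rewrite lter_normr.
Qed.

Let swap_count (e : {ffun 'I_N -> bool}) z a : 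
  large_rows (mix (fun t => e t.1) g g') z a =
     [set i in I | big (sign_pattern phi Gd (theta z a)) (e i) i] /\
  large_rows (mix (fun t => e t.1) g' g) z a =
     [set i in I | big (sign_pattern phi Gd (theta z a)) (~~ e i) i].
Proof.
split; apply/setP => i; rewrite [RHS]inE; case: (boolP (i \in I)) => iI /=;
  rewrite ?[in LHS]inE ?(negPf iI) // iI /= -(big_pattern _ _ _ iI) inE iI /=;
  congr (_ < _ ^+ 2); congr (_ + _); apply: eq_bigr => j _;
  by rewrite !ffunE /=; case: (e i).
Qed.

(** Give weight 4/9 to each large row of the first sample and 3/2 to each large row
of the second.  For one pattern the exchanges of different rows are independent,
so the mean of the total weight is a product over the rows of [I].  A row large
in one sample only has mean weight (4/9 + 3/2)/2 < 1, a row large in both has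
weight (4/9)(3/2) < 1, and an exchange that leaves few large rows in one sample
and many in the other has total weight at least (4/9)^A (3/2)^B. *)
Let pattern_prob C :
  Ex (coin R) (fun e : {ffun 'I_N -> bool} =>
    ((#|[set i in I | big C (e i) i]| <= A)%N && (B <= #|[set i in I | big C (~~ e i) i]|)%N)%:R)
  <= (9 / 4) ^+ A * (2 / 3) ^+ B.
Proof.
pose w (i : 'I_N) (c : bool) : R :=
  if i \in I then (4 / 9) ^+ (big C c i) * (3 / 2) ^+ (big C (~~ c) i) else 1.
apply: (@le_trans _ _ (Ex (coin R) (fun e : {ffun 'I_N -> bool} =>
   ((9 / 4) ^+ A * (2 / 3) ^+ B) * \prod_i w i (e i)))).
  apply: (ler_Ex (coin_ge0 R)) => e.
  have -> : \prod_i w i (e i) = (4 / 9) ^+ #|[set i in I | big C (e i) i]| *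
      (3 / 2) ^+ #|[set i in I | big C (~~ e i) i]|.
    rewrite -!prodr_const [X in _ = X * _]big_mkcond [X in _ = _ * X]big_mkcond -big_split /=.
    apply: eq_bigr => i _; rewrite /w !inE.
    by case: (i \in I); rewrite ?mulr1 //=; congr (_ * _); case: (big _ _ _).
  have w0 : 0 <= ((9 / 4) ^+ A * (2 / 3) ^+ B *
    ((4 / 9) ^+ #|[set i in I | big C (e i) i]| *
     (3 / 2) ^+ #|[set i in I | big C (~~ e i) i]|)) :> R.
    by rewrite !mulr_ge0 // exprn_ge0 //; lra.
  case: andP => // -[h1 h2].
  have -> : forall x y z t : R, x * y * (z * t) = (x * z) * (y * t) by move=> *; ring.
  rewrite -{1}[1]mulr1; apply: ler_pM => //.
    rewrite -(subnK h1) exprD -mulrA -exprMn (_ : 9 / 4 * (4 / 9) = 1 :> R); last by field.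
    by rewrite expr1n mulr1 exprn_ege1 //; lra.
  rewrite -(subnK h2) exprD mulrCA -exprMn (_ : 2 / 3 * (3 / 2) = 1 :> R); last by field.
  by rewrite expr1n mulr1 exprn_ege1 //; lra.
rewrite ExZ Ex_prod ger_pMr; last by rewrite mulr_gt0 // exprn_gt0 //; lra.
apply: prodr_ile1 => i _; rewrite big_bool /coin /w /=.
case: (i \in I); last by apply/andP; split; lra.
by apply/andP; split; case: (big C true i); case: (big C false i); rewrite /= ?expr0 ?expr1; lra.
Qed.

Lemma swap_prob x : 0 < x <= 1 ->
  Ex (coin R) (fun e : {ffun 'I_N -> bool} =>
    (`[< separated (mix (fun t => e t.1) g g') (mix (fun t => e t.1) g' g) >])%:R) <=
  x ^- (#|J| + (k + 1)) * (1 + x) ^+ (4 * #|I|) * ((9 / 4) ^+ A * (2 / 3) ^+ B).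
Proof.
move=> x01.
have cG : #|Gd| = (4 * #|I|)%N.
  by rewrite cardsX cardsT card_prod card_bool mulnC.
have := card_sign_patterns phi Gd x01; rewrite cG => hc.
apply: (@le_trans _ _ (#|sign_patterns phi Gd|%:R * ((9 / 4) ^+ A * (2 / 3) ^+ B))); last first.
  by apply: ler_wpM2r hc; rewrite mulr_ge0 // exprn_ge0 //; lra.
rewrite mulr_natl -sumr_const.
apply: le_trans (ler_sum _ (fun C _ => pattern_prob C)).
rewrite -Ex_sum; apply: (ler_Ex (coin_ge0 R)) => e.
case: asboolP => [[z [a [_ h1 h2]]]|_]; last by apply: sumr_ge0 => C _; rewrite ler0n.
have [e1 e2] := swap_count e z a.
rewrite (bigD1 (sign_pattern phi Gd (theta z a))) /=; last exact: sign_pattern_in.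
rewrite -e1 -e2 h1 h2 lerDl.
by apply: sumr_ge0 => C _; rewrite ler0n.
Qed.

End Patterns.

(** The gain (9/4)^A (2/3)^B of the random exchange beats the number of patterns as
soon as |J| + k is small compared with |I|. *)
Lemma degenerate_prob x : 0 < x <= 1 -> (0 < #|I|)%N ->
  Pr p degenerate <= 96 / beta *
   (x ^- (#|J| + (k + 1)) * (1 + x) ^+ (4 * #|I|) * ((9 / 4) ^+ A * (2 / 3) ^+ B)).
Proof.
move=> x01 I0; have {}I0 : 0 < #|I|%:R :> R by rewrite ltr0n.
have b0 : 0 < beta / 96 by rewrite divr_gt0.
rewrite -[96 / beta]invf_div mulrC ler_pdivlMr // mulrC.
apply: le_trans (symmetrization I0) _.
set D := Ex _ _; set rhs := (X in _ <= X).
have -> : D = Ex (coin R) (fun e : {ffun 'I_N -> bool} => D).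
  by rewrite (Ex_cst 'I_N (coin_sum1 R)).
under eq_Ex => e do rewrite /D /Pr (Ex_swap _ (fun t => e t.1)).
rewrite Ex_exchange; apply: (Ex_le_cst p_ge0 p_sum1) => g.
rewrite Ex_exchange; apply: (Ex_le_cst p_ge0 p_sum1) => g'.
exact: swap_prob.
Qed.

End GhostSample.

(** * Euclidean geometry and orthonormal families *)

Section Euclid.
Variable R : realType.

Definition dot N (u v : 'cV[R]_N) : R := (u^T *m v) 0 0.
Definition nsq N (v : 'cV[R]_N) : R := dot v v.

Lemma dotE N (u v : 'cV[R]_N) : dot u v = \sum_i u i 0 * v i 0.
Proof. by rewrite /dot mxE; apply: eq_bigr => i _; rewrite mxE. Qed.

Lemma nsqE N (v : 'cV[R]_N) : nsq v = \sum_i v i 0 ^+ 2.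
Proof. by rewrite /nsq dotE; apply: eq_bigr => i _; rewrite expr2. Qed.

Lemma dotC N (u v : 'cV[R]_N) : dot u v = dot v u.
Proof. by rewrite !dotE; apply: eq_bigr => i _; rewrite mulrC. Qed.

Lemma dotDl N (u v w : 'cV[R]_N) : dot (u + v) w = dot u w + dot v w.
Proof. by rewrite /dot raddfD mulmxDl mxE. Qed.

Lemma dotZl N a (u v : 'cV[R]_N) : dot (a *: u) v = a * dot u v.
Proof. by rewrite /dot linearZ -scalemxAl mxE. Qed.

Lemma dotDr N (u v w : 'cV[R]_N) : dot w (u + v) = dot w u + dot w v.
Proof. by rewrite dotC dotDl !(dotC w). Qed.

Lemma dotZr N a (u v : 'cV[R]_N) : dot u (a *: v) = a * dot u v.
Proof. by rewrite dotC dotZl dotC. Qed.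

Lemma dotNr N (u v : 'cV[R]_N) : dot u (- v) = - dot u v.
Proof. by rewrite -scaleN1r dotZr mulN1r. Qed.

Lemma dotNl N (u v : 'cV[R]_N) : dot (- u) v = - dot u v.
Proof. by rewrite dotC dotNr dotC. Qed.

Lemma dot_adj N M (A : 'M[R]_(M, N)) u v : dot (A *m u) v = dot u (A^T *m v).
Proof. by rewrite /dot trmx_mul mulmxA. Qed.

Lemma dot0r N (u : 'cV[R]_N) : dot u 0 = 0.
Proof. by rewrite /dot mulmx0 mxE. Qed.

Lemma nsq_ge0 N (v : 'cV[R]_N) : 0 <= nsq v.
Proof. by rewrite nsqE sumr_ge0 // => i _; exact: sqr_ge0. Qed.

Lemma nsq_eq0 N (v : 'cV[R]_N) : nsq v = 0 -> v = 0.
Proof.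
rewrite nsqE => /eqP; rewrite psumr_eq0 => [|i _]; last exact: sqr_ge0.
move/allP => h; apply/colP => i; rewrite mxE.
by have := h i (mem_index_enum _); rewrite sqrf_eq0 => /eqP.
Qed.

Lemma nsq_gt0 N (v : 'cV[R]_N) : (0 < nsq v) = (v != 0).
Proof.
rewrite lt_neqAle nsq_ge0 andbT eq_sym; congr (~~ _).
by apply/eqP/eqP => [/nsq_eq0 //|->]; rewrite /nsq dot0r.
Qed.

Lemma nsqZ N a (v : 'cV[R]_N) : nsq (a *: v) = a ^+ 2 * nsq v.
Proof. by rewrite /nsq dotZl dotZr mulrA. Qed.

Lemma nsqD N (u v : 'cV[R]_N) : nsq (u + v) = nsq u + 2 * dot u v + nsq v.
Proof. by rewrite /nsq dotDl !dotDr (dotC v u); ring. Qed.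

Lemma nsqB N (u v : 'cV[R]_N) : nsq (u - v) = nsq u - 2 * dot u v + nsq v.
Proof. by rewrite /nsq dotDl !dotDr !dotNl !dotNr (dotC v u); ring. Qed.

Lemma cauchy_schwarz N (u v : 'cV[R]_N) : dot u v ^+ 2 <= nsq u * nsq v.
Proof.
have [->|v0] := eqVneq v 0; first by rewrite dot0r expr0n mulr_ge0 // nsq_ge0.
have := nsq_ge0 (nsq v *: u - dot u v *: v); rewrite nsqB !nsqZ dotZl dotZr.
have -> : nsq v ^+ 2 * nsq u - 2 * (nsq v * (dot u v * dot u v)) + dot u v ^+ 2 * nsq v =
  nsq v * (nsq u * nsq v - dot u v ^+ 2) by ring.
by rewrite pmulr_rge0 ?nsq_gt0 // subr_ge0.
Qed.

Definition orthonormal_rows k N (W : 'M[R]_(k, N)) : Prop := W *m W^T = 1%:M.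

Lemma bessel k N (W : 'M[R]_(k, N)) v : orthonormal_rows W -> nsq (W *m v) <= nsq v.
Proof.
move=> hW; rewrite -subr_ge0.
have -> : nsq v - nsq (W *m v) = nsq (v - W^T *m (W *m v)).
  have e1 : dot v (W^T *m (W *m v)) = nsq (W *m v) by rewrite dotC dot_adj trmxK.
  have e2 : nsq (W^T *m (W *m v)) = nsq (W *m v).
    by rewrite /nsq dot_adj trmxK (mulmxA W) hW mul1mx.
  by rewrite nsqB e1 e2; ring.
exact: nsq_ge0.
Qed.

Lemma orthonormal_extend k N (W : 'M[R]_(k, N)) (w : 'cV[R]_N) :
  orthonormal_rows W -> W *m w = 0 -> nsq w = 1 -> orthonormal_rows (col_mx W w^T).
Proof.
move=> hW Ww w1; rewrite /orthonormal_rows tr_col_mx trmxK mul_col_row hW Ww.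
have -> : w^T *m W^T = 0 by rewrite -trmx_mul Ww trmx0.
have -> : w^T *m w = 1%:M.
  by apply/matrixP => i j; rewrite !ord1 -[LHS]/(nsq w) w1 mxE eqxx.
by rewrite -scalar_mx_block.
Qed.

(** Gram-Schmidt: while fewer than N - q vectors have been found, they and the
columns of [E] together do not span, so another unit vector is available. *)
Lemma orthonormal_annihilator N q (E : 'M[R]_(N, q)) k : (k + q <= N)%N ->
  exists Q : 'M[R]_(k, N), orthonormal_rows Q /\ Q *m E = 0.
Proof.
elim: k => [|k IH] kq.
  exists 0; split; last by rewrite mul0mx.
  by apply/matrixP => -[].
have [|Q [hQ QE]] := IH; first by lia.
pose M := row_mx E Q^T.
have : kermx M != 0.
  rewrite kermx_eq0 /row_free neq_ltn; apply/orP; left.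
  by apply: leq_ltn_trans (rank_leq_col M) _; lia.
case/rowV0Pn => r rM r0.
have {rM} : r *m M = 0 by apply/sub_kermxP.
rewrite mul_mx_row -(row_mx0 _ 1 q k) => /eq_row_mx [rE rQ].
have nr : 0 < nsq r^T.
  by rewrite nsq_gt0; apply: contraNneq r0 => h; rewrite -[r]trmxK h trmx0.
pose w := (Num.sqrt (nsq r^T))^-1 *: r^T.
rewrite -addn1; exists (col_mx Q w^T); split.
  apply: orthonormal_extend => //.
    by rewrite -scalemxAr -[Q]trmxK -trmx_mul rQ trmx0 scaler0.
  by rewrite nsqZ exprVn sqr_sqrtr ?nsq_ge0 // mulVf // gt_eqF.
by rewrite mul_col_mx QE linearZ /= trmxK -scalemxAl rE scaler0 col_mx0.
Qed.

(** Either bad unit vectors can be collected greedily up to [K], or the process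
stops and leaves no bad vector orthogonal to those already found.  An upper bound
on the size of bad systems therefore yields a maximal one. *)
Lemma maximal_orthonormal N (bad : 'cV[R]_N -> Prop) (K : nat) :
  (exists W : 'M[R]_(K, N), orthonormal_rows W /\ forall l, bad (row l W)^T) \/
  (exists k (W : 'M[R]_(k, N)), [/\ orthonormal_rows W, forall l, bad (row l W)^T &
     forall w, nsq w = 1 -> W *m w = 0 -> ~ bad w]).
Proof.
elim: K => [|K [[W [hW bW]]|]];
  [|case: (pselect (exists w, [/\ nsq w = 1, W *m w = 0 & bad w]))|by right].
- left; exists 0; split; last by case.
  by apply/matrixP => -[].
- case=> w [w1 Ww bw]; left; rewrite -addn1; exists (col_mx W w^T); split.
    exact: orthonormal_extend.
  move=> l; case: (split_ordP l) => j ->; first by rewrite rowKu.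
  by rewrite rowKd row_id trmxK.
move=> h; right; exists K, W; split => // w w1 Ww bw; apply: h; by exists w.
Qed.

Lemma pigeonhole_avg (T : finType) (S : {set T}) (c : T -> R) : (0 < #|S|)%N ->
  exists2 i, i \in S & c i * #|S|%:R <= \sum_(j in S) c j.
Proof.
move=> S0; case: (pselect (exists2 i, i \in S & c i * #|S|%:R <= \sum_(j in S) c j)) => // h.
have /card_gt0P [i0 i0S] := S0.
suff : \sum_(i in S) \sum_(j in S) c j < \sum_(i in S) c i * #|S|%:R.
  by rewrite sumr_const -mulr_suml mulr_natr ltxx.
have hlt i : i \in S -> \sum_(j in S) c j < c i * #|S|%:R.
  by move=> iS; rewrite ltNge; apply/negP => le; apply: h; exists i.
rewrite (bigD1 i0) //= [ltRHS](bigD1 i0) //= ltr_leD ?hlt //.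
by apply: ler_sum => i /andP[iS _]; rewrite ltW // hlt.
Qed.

(** Add points one by one, each time the point of [S] with the least interaction
with those already chosen.  The total interaction of the m chosen points with
all others is at most m, so the best of the at least |S|/2 remaining points
adds at most 2m/|S|, counted twice by symmetry. *)
Lemma weakly_interacting_subset (T : finType) (h : T -> T -> R) (S : {set T}) m :
  (forall i j, 0 <= h i j) -> (forall i j, h i j = h j i) ->
  (forall j, \sum_i h i j <= 1) -> (m.*2 <= #|S|)%N ->
  exists I : {set T}, [/\ I \subset S, #|I| = m &
    #|S|%:R * (\sum_(i in I) \sum_(j in I | j != i) h i j) <= 4 * m%:R ^+ 2].
Proof.
move=> h0 hC h1; elim: m => [|m IH] mS.
  exists set0; rewrite sub0set cards0; split => //.
  by rewrite big_set0 mulr0 expr0n mulr0.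
have [|I [IS cI hI]] := IH; first by lia.
have cSI : #|S :\: I| = (#|S| - m)%N by rewrite cardsD (setIidPr IS) cI.
have [|i] := @pigeonhole_avg _ (S :\: I) (fun i => \sum_(j in I) h i j); first by rewrite cSI; lia.
rewrite !inE => /andP[iI iS]; rewrite exchange_big /= cSI => hi.
set c := \sum_(j in I) h i j in hi.
have c0 : 0 <= c by apply: sumr_ge0.
have {hi} cm : c * (#|S| - m)%:R <= m%:R.
  apply: le_trans hi _; rewrite -cI -sumr_const; apply: ler_sum => j _.
  apply: le_trans (h1 j); rewrite [leRHS](bigID (mem (S :\: I))) /= lerDl.
  by apply: sumr_ge0.
exists (i |: I); split.
- by rewrite subUset sub1set iS.
- by rewrite cardsU1 iI cI.
rewrite big_setU1 //= big_mkcondr /= big_setU1 //= eqxx add0r.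
have -> : \sum_(j in I) (if j != i then h i j else 0) = c.
  by apply: eq_bigr => j jI; case: eqVneq => // e; rewrite -e jI in iI.
have -> : \sum_(i0 in I) \sum_(j in i |: I | j != i0) h i0 j =
   c + \sum_(i in I) \sum_(j in I | j != i) h i j.
  rewrite -big_split; apply: eq_bigr => i0 i0I /=.
  rewrite [LHS]big_mkcondr /= big_setU1 //= [in RHS]big_mkcondr; congr (_ + _).
  case: eqVneq => [e|_]; last by rewrite hC.
  by rewrite e i0I in iI.
move: hI; set X := \sum_(_ in _) _; move: cm.
have -> : (#|S| - m)%:R = #|S|%:R - m%:R :> R by rewrite natrB //; lia.
have : m%:R * 2 <= #|S|%:R :> R by rewrite -natrM ler_nat; lia.
rewrite -[m.+1]addn1 natrD; have : 0 <= m%:R :> R by rewrite ler0n.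
move: (#|S|%:R : R) (m%:R : R) (X) c0 => s x Y c0 x0 xs H1 H2.
have H3 : 0 <= c * (s - x * 2) by apply: mulr_ge0; lra.
have H4 : s * (c + (c + Y)) = 2 * (c * s) + s * Y by ring.
have H5 : c * (s - x * 2) = 2 * (c * (s - x)) - c * s by ring.
by rewrite H4; nra.
Qed.

Definition mask N (I : {set 'I_N}) : 'M[R]_N := diag_mx (\row_i (i \in I)%:R).

Lemma maskE N (I : {set 'I_N}) q (A : 'M[R]_(N, q)) i j :
  (mask I *m A) i j = (i \in I)%:R * A i j.
Proof. by rewrite mul_diag_mx !mxE. Qed.

Lemma maskK N (I : {set 'I_N}) : mask I *m mask I = mask I.
Proof.
by apply/matrixP => i j; rewrite maskE !mxE; case: (i \in I); rewrite ?mul1r ?mul0r ?mul0rn.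
Qed.

Lemma mask_tr N (I : {set 'I_N}) : (mask I)^T = mask I.
Proof. by rewrite tr_diag_mx. Qed.

End Euclid.

(** * Eliminating a subspace of proportional codimension *)

Section Restriction.
Variable R : realType.

Lemma projector_sum_sq k N (Q : 'M[R]_(k, N)) j : orthonormal_rows Q ->
  \sum_i (Q^T *m Q) i j ^+ 2 = (Q^T *m Q) j j.
Proof.
move=> hQ; have {2}<- : (Q^T *m Q)^T *m (Q^T *m Q) = Q^T *m Q.
  by rewrite trmx_mul trmxK mulmxA -(mulmxA Q^T) hQ mulmx1.
by rewrite [RHS]mxE; apply: eq_bigr => i _; rewrite [in RHS]mxE expr2.
Qed.

Lemma projector_diag_le1 k N (Q : 'M[R]_(k, N)) j : orthonormal_rows Q ->
  0 <= (Q^T *m Q) j j <= 1.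
Proof.
move=> hQ; have h := projector_sum_sq j hQ.
have P0 : 0 <= (Q^T *m Q) j j by rewrite -h sumr_ge0 // => i _; exact: sqr_ge0.
rewrite P0 /=; have : (Q^T *m Q) j j ^+ 2 <= (Q^T *m Q) j j.
  rewrite -{2}h (bigD1 j) //= lerDl sumr_ge0 // => i _; exact: sqr_ge0.
by move: P0; set x := (Q^T *m Q) j j; nra.
Qed.

Lemma projector_trace k N (Q : 'M[R]_(k, N)) : orthonormal_rows Q ->
  \sum_j (Q^T *m Q) j j = k%:R.
Proof. by move=> hQ; rewrite -[LHS]/(\tr (Q^T *m Q)) mxtrace_mulC hQ mxtrace1. Qed.

Lemma projector_large_diag k N (Q : 'M[R]_(k, N)) (kappa : R) : orthonormal_rows Q ->
  kappa * N%:R <= k%:R -> 0 <= kappa ->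
  kappa / 2 * N%:R <= #|[set j | kappa / 2 <= (Q^T *m Q) j j]|%:R.
Proof.
move=> hQ; rewrite -(projector_trace hQ) => hk k0.
suff : \sum_j (Q^T *m Q) j j <=
    #|[set j | kappa / 2 <= (Q^T *m Q) j j]|%:R + kappa / 2 * N%:R by lra.
have -> : kappa / 2 * N%:R = \sum_(j < N) kappa / 2.
  by rewrite sumr_const card_ord mulr_natr.
rewrite -sum1_card natr_sum [X in X + _]big_mkcond -big_split.
apply: ler_sum => j _; rewrite inE /=; have /andP[] := projector_diag_le1 j hQ.
move: ((Q^T *m Q) j j) => x x0 x1.
by case: (leP (kappa / 2) x) => h /=; lra.
Qed.

(** The Gram matrix of the columns of [Q] indexed by [I] is a diagonal part, at
least [kappa / 2], plus an off-diagonal part of squared Hilbert-Schmidt norm at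
most [s].  A unit vector on which the form is below [kappa / 4] is moved by the
off-diagonal part by at least [kappa / 4]; by Bessel's inequality an orthonormal
system of such vectors has at most 16 s / kappa^2 members.  Taking a maximal
system for [W] avoids the spectral theorem. *)
Lemma gram_lower_bound k N (Q : 'M[R]_(k, N)) (kappa s : R) (I : {set 'I_N}) :
  0 < kappa ->
  (forall j, j \in I -> kappa / 2 <= (Q^T *m Q) j j) ->
  \sum_(i in I) \sum_(j in I | j != i) (Q^T *m Q) i j ^+ 2 <= s ->
  exists l (W : 'M[R]_(l, N)), [/\ orthonormal_rows W, W *m mask R I = W,
    l%:R * kappa ^+ 2 <= 16 * s &
    forall w, mask R I *m w = w -> W *m w = 0 -> kappa / 4 * nsq w <= nsq (Q *m w)].
Proof.
move=> k0 hI hs; set P := Q^T *m Q in hI hs.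
pose O : 'M[R]_N := \matrix_(i, j) if [&& i \in I, j \in I & j != i] then P i j else 0.
pose bad w := mask R I *m w = w /\ nsq (Q *m w) < kappa / 4 * nsq w.
have Ohs : \sum_i nsq ((row i O)^T) <= s.
  apply: le_trans hs; rewrite [leRHS]big_mkcond; apply: ler_sum => i _.
  rewrite nsqE; case: (boolP (i \in I)) => iI; last first.
    by rewrite big1 // => j _; rewrite !mxE (negPf iI) expr0n.
  rewrite [leRHS]big_mkcond; apply: ler_sum => j _; rewrite !mxE iI /=.
  by case: ifP => //; rewrite expr0n.
have gram w : mask R I *m w = w -> kappa / 2 * nsq w + dot w (O *m w) <= nsq (Q *m w).
  move=> hw; have w0 i : i \notin I -> w i 0 = 0.
    by move=> iI; rewrite -hw maskE (negPf iI) mul0r.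
  rewrite /nsq [leRHS]dot_adj mulmxA -/P !dotE mulr_sumr -big_split /=.
  apply: ler_sum => i _; case: (boolP (i \in I)) => iI;
    last by rewrite (w0 i iI) !mul0r mulr0 addr0.
  rewrite [(O *m w) i 0]mxE [(P *m w) i 0]mxE [in leRHS](bigD1 i) //= mulrDr.
  have -> : \sum_j O i j * w j 0 = \sum_(j | j != i) P i j * w j 0.
    rewrite [RHS]big_mkcond; apply: eq_bigr => j _; rewrite mxE iI /=.
    case: (boolP (j \in I)) => jI /=; first by case: ifP => //; rewrite mul0r.
    by rewrite (w0 j jI) !mulr0 if_same.
  rewrite lerD2r; have := hI i iI; have := sqr_ge0 (w i 0); rewrite expr2.
  by set x := w i 0; move: (P i i) => y; nra.
have big w : bad w -> nsq w = 1 -> kappa ^+ 2 / 16 <= nsq (O *m w).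
  case=> /gram; set y := nsq (Q *m w) => h1 h2 w1; rewrite w1 in h1 h2.
  have := cauchy_schwarz w (O *m w); rewrite w1 mul1r; apply: le_trans.
  move: h1 h2; set d := dot _ _; nra.
have count l (W : 'M[R]_(l, N)) : orthonormal_rows W -> (forall j, bad (row j W)^T) ->
    l%:R * kappa ^+ 2 <= 16 * s.
  move=> hW hb.
  suff : l%:R * (kappa ^+ 2 / 16) <= s by lra.
  apply: le_trans Ohs; 
  have -> : l%:R * (kappa ^+ 2 / 16) = \sum_(j < l) kappa ^+ 2 / 16.
    by rewrite sumr_const card_ord mulr_natl.
  apply: (@le_trans _ _ (\sum_(j < l) nsq (O *m (row j W)^T))).
    apply: ler_sum => j _; apply: big (hb j) _.
    transitivity ((W *m W^T) j j); last by rewrite hW mxE eqxx.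
    by rewrite nsqE mxE; apply: eq_bigr => i _; rewrite !mxE expr2.
  apply: (@le_trans _ _ (\sum_i nsq (W *m (row i O)^T))); last first.
    by apply: ler_sum => i _; exact: bessel.
  rewrite le_eqVlt; apply/orP; left; apply/eqP.
  under eq_bigr do rewrite nsqE; under [RHS]eq_bigr do rewrite nsqE.
  rewrite exchange_big; apply: eq_bigr => i _; apply: eq_bigr => j _.
  rewrite !mxE; congr (_ ^+ 2); apply: eq_bigr => x _.
  by rewrite ![in LHS]mxE ![in RHS]mxE mulrC.
have s0 : 0 <= s.
  by apply: le_trans Ohs; apply: sumr_ge0 => i _; exact: nsq_ge0.
pose K := (Num.truncn (16 * s / kappa ^+ 2)).+1.
have k2 : 0 < kappa ^+ 2 by rewrite exprn_gt0.
case: (maximal_orthonormal bad K) => [[W [hW hb]]|[l [W [hW hb hmax]]]].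
  have := count _ _ hW hb; rewrite -ler_pdivlMr // leNgt.
  by rewrite truncnS_gt.
exists l, W; split => //; last first.
- move=> w hw Ww; have [->|w0] := eqVneq w 0.
    by rewrite mulmx0 /nsq !dot0r mulr0.
  rewrite leNgt; apply/negP => hlt.
  have nw : 0 < nsq w by rewrite nsq_gt0.
  pose a := (Num.sqrt (nsq w))^-1.
  have a2 : a ^+ 2 * nsq w = 1 by rewrite exprVn sqr_sqrtr ?nsq_ge0 // mulVf // gt_eqF.
  apply: (hmax (a *: w)); rewrite ?nsqZ // -?scalemxAr ?Ww ?scaler0 //.
  split; first by rewrite -scalemxAr hw.
  rewrite -scalemxAr !nsqZ a2 mulr1.
  have -> : kappa / 4 = a ^+ 2 * (kappa / 4 * nsq w) by rewrite mulrCA a2 mulr1.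
  by rewrite ltr_pM2l // -(pmulr_lgt0 _ nw) a2.
- exact: count hb.
apply/row_matrixP => i; rewrite row_mul -[RHS]trmxK; have [<- _] := hb i.
by rewrite trmx_mul trmxK mask_tr.
Qed.


(** Let [Pi] project onto the vectors supported by [I] and orthogonal to the rows
of [W], where [Q] is bounded below.  The map [S] is the least-squares inverse of
[Q] there, written with [H], which is [Pi *m P *m Pi] on the range of [Pi] and
the identity on its complement.  Since [S *m Q] fixes the range of [Pi], it
differs from the mask of [I], on vectors supported by [I], by a map that factors
through [W]. *)
Lemma restricted_left_inverse k N l (Q : 'M[R]_(k, N)) (W : 'M[R]_(l, N)) (I : {set 'I_N}) (c : R) :
  0 < c -> orthonormal_rows Q -> orthonormal_rows W -> W *m mask R I = W ->
  (forall w, mask R I *m w = w -> W *m w = 0 -> c * nsq w <= nsq (Q *m w)) ->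
  exists (S : 'M[R]_(N, k)) (U : 'M[R]_(N, l)),
    S *m Q *m mask R I = mask R I - U *m W /\
    forall x, c * nsq (S *m Q *m x) <= nsq x.
Proof.
move=> c0 hQ hW WD low; set D := mask R I in WD low *.
have DW : D *m W^T = W^T by rewrite -{2}WD trmx_mul mask_tr.
pose Pi := D - W^T *m W; pose C := 1%:M - Pi; pose P := Q^T *m Q.
have DPi : D *m Pi = Pi by rewrite mulmxBr maskK mulmxA DW.
have WPi : W *m Pi = 0 by rewrite mulmxBr WD mulmxA hW mul1mx subrr.
have PiPi : Pi *m Pi = Pi by rewrite {1}/Pi mulmxBl DPi -mulmxA WPi mulmx0 subr0.
have PiT : Pi^T = Pi by rewrite raddfB /= mask_tr trmx_mul trmxK.
have CC : C *m C = C by rewrite {2}/C mulmxBr mulmx1 {2}/C mulmxBl mul1mx PiPi subrr subr0.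
have PiC : Pi *m C = 0 by rewrite mulmxBr mulmx1 PiPi subrr.
have CPi : C *m Pi = 0 by rewrite mulmxBl mul1mx PiPi subrr.
have CT : C^T = C by rewrite raddfB /= trmx1 PiT.
have lowPi v : c * nsq (Pi *m v) <= nsq (Q *m (Pi *m v)).
  by apply: low; rewrite mulmxA ?DPi ?WPi ?mul0mx.
pose H := Pi *m P *m Pi + C.
have HC : H *m C = C by rewrite mulmxDl -mulmxA PiC mulmx0 add0r CC.
have CH : C *m H = C by rewrite mulmxDr !mulmxA CPi !mul0mx add0r CC.
have dotH v : dot v (H *m v) = nsq (Q *m (Pi *m v)) + nsq (C *m v).
  rewrite mulmxDl dotDr; congr (_ + _).
    by rewrite /nsq dot_adj dot_adj PiT /P !mulmxA.
  by rewrite /nsq dot_adj CT mulmxA CC.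
have Hunit : H \in unitmx.
  rewrite -row_free_unit -kermx_eq0; apply: contraT => /rowV0Pn [r /sub_kermxP rH r0].
  have HT : H^T = H.
    by rewrite /H /P raddfD /= CT !trmx_mul trmxK PiT !mulmxA.
  have := dotH r^T; rewrite -[H]HT -trmx_mul rH trmx0 dot0r => /esym/eqP.
  rewrite paddr_eq0 ?nsq_ge0 // => /andP[/eqP h1 /eqP/nsq_eq0 h2].
  have h3 : Pi *m r^T = 0.
    apply: nsq_eq0; apply/eqP; rewrite eq_le nsq_ge0 andbT.
    by rewrite -(pmulr_rle0 _ c0) -h1 lowPi.
  have : r^T = 0 by rewrite -[r^T]mul1mx -(subrK Pi 1%:M) mulmxDl h3 h2 addr0.
  by move/(congr1 trmx); rewrite trmxK trmx0 => /eqP; rewrite (negPf r0).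
pose S := invmx H *m Pi *m Q^T; pose M := S *m Q.
have MPi : M *m Pi = Pi.
  rewrite /M /S -!mulmxA (mulmxA Q^T) -/P (mulmxA Pi).
  have -> : Pi *m P *m Pi = H - C by rewrite addrK.
  rewrite mulmxBr mulVmx // -{1}HC mulmxA mulVmx // mul1mx.
  by rewrite /C opprB addrC subrK.
exists S, (W^T - M *m W^T); rewrite -/M; split.
  rewrite mulmxBl -{1}(subrK (W^T *m W) D) mulmxDr -/Pi MPi mulmxA.
  by rewrite opprB addrA /Pi addrAC.
move=> x; set a := M *m x.
have Ha : H *m a = Pi *m (P *m x).
  by rewrite /a /M /S /P !mulmxA mulmxV // mul1mx.
have Ca : C *m a = 0 by rewrite -CH -mulmxA Ha mulmxA CPi mul0mx.
have Pia : Pi *m a = a.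
  have -> : Pi = 1%:M - C by rewrite opprB addrCA subrr addr0.
  by rewrite mulmxBl mul1mx Ca subr0.
have e : nsq (Q *m a) = dot (Q *m a) (Q *m x).
  have := dotH a; rewrite Ca Pia {2}/nsq dot0r addr0 => <-.
  by rewrite Ha -{1}PiT -dot_adj Pia [RHS]dot_adj !mulmxA.
apply: le_trans (bessel x hQ).
have h1 : c * nsq a <= nsq (Q *m a) by have := lowPi a; rewrite Pia.
apply: le_trans h1 _.
have := cauchy_schwarz (Q *m a) (Q *m x); rewrite -e expr2.
have := nsq_ge0 (Q *m a); have := nsq_ge0 (Q *m x).
move: (nsq _) (nsq _) => y z y0; rewrite le_eqVlt => /orP[/eqP<- //|z0].
by rewrite ler_pM2l.
Qed.

(** With [Q] an orthonormal basis of the orthogonal complement of [E], the average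
of the squared norms of its columns is at least [kappa], so a proportion
[kappa / 2] of the columns has squared norm at least [kappa / 2].  Among these, m
weakly interacting columns have off-diagonal energy of order m^2 / N, a small
multiple of m when m is a small multiple of N; the number of directions lost in
[W] is of the same order. *)
Lemma dimension_reduction N q m (E : 'M[R]_(N, q)) (kappa zeta : R) :
  0 < kappa -> (0 < N)%N -> (q <= N)%N -> kappa * N%:R <= (N - q)%:R ->
  4 * m%:R <= kappa * N%:R -> 128 * m%:R <= zeta * kappa ^+ 3 * N%:R ->
  exists (I : {set 'I_N}) (l : nat) (M : 'M[R]_N) (U : 'M[R]_(N, l)) (W : 'M[R]_(l, N)),
   [/\ #|I| = m, l%:R <= zeta * m%:R, M *m E = 0,
     forall x, kappa / 4 * nsq (M *m x) <= nsq x &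
     M *m mask R I = mask R I - U *m W].
Proof.
move=> k0 N0 qN kN h4 h128.
have [|Q [hQ QE]] := @orthonormal_annihilator R N q E (N - q); first by rewrite subnK.
set S0 := [set j | kappa / 2 <= (Q^T *m Q) j j].
have cS : kappa / 2 * N%:R <= #|S0|%:R.
  by apply: projector_large_diag => //; exact: ltW.
have Npos : 0 < N%:R :> R by rewrite ltr0n.
have [| | | |I [IS cI hI]] := @weakly_interacting_subset R _
    (fun i j => (Q^T *m Q) i j ^+ 2) S0 m.
- by move=> i j; exact: sqr_ge0.
- by move=> i j; rewrite -[Q^T *m Q in LHS]trmxK trmx_mul trmxK mxE.
- by move=> j; rewrite projector_sum_sq //; case/andP: (projector_diag_le1 j hQ).
- rewrite -muln2 -(ler_nat R) natrM; lra.
set s := \sum_(_ in _) _ in hI.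
have [|l [W [hW WD hl hlow]]] := @gram_lower_bound _ _ Q kappa s I k0 _ (lexx _).
  by move=> j /(subsetP IS); rewrite inE.
have k4 : 0 < kappa / 4 by lra.
have [S [U [h1 h2]]] := restricted_left_inverse k4 hQ hW WD hlow.
exists I, l, (S *m Q), U, W; split => //; last by rewrite -mulmxA QE mulmx0.
have s0 : 0 <= s by do 2!(apply: sumr_ge0 => ? _); exact: sqr_ge0.
have hs : kappa * N%:R * s <= 8 * m%:R ^+ 2 by nra.
have k2 : 0 < kappa ^+ 3 * N%:R by rewrite mulr_gt0 // exprn_gt0.
rewrite -(ler_pM2r k2).
have e1 : l%:R * (kappa ^+ 3 * N%:R) = l%:R * kappa ^+ 2 * (kappa * N%:R) by ring.
have : l%:R * kappa ^+ 2 * (kappa * N%:R) <= 16 * s * (kappa * N%:R).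
  by apply: ler_wpM2r => //; rewrite mulr_ge0 // ltW.
rewrite e1 => h; apply: le_trans h _.
have -> : 16 * s * (kappa * N%:R) = 16 * (kappa * N%:R * s) by ring.
apply: (@le_trans _ _ (128 * m%:R * m%:R)).
  by apply: (@le_trans _ _ (16 * (8 * m%:R ^+ 2))); [rewrite ler_pM2l // | rewrite expr2; lra].
have -> : zeta * m%:R * (kappa ^+ 3 * N%:R) = zeta * kappa ^+ 3 * N%:R * m%:R by ring.
by apply: ler_wpM2r.
Qed.

End Restriction.

(** * One block of columns *)

Section Block.
Variables (R : realType) (G : finType) (p val : G -> R) (beta : R).
Hypothesis p_ge0 : forall x, 0 <= p x.
Hypothesis p_sum1 : \sum_x p x = 1.
Hypothesis beta_gt0 : 0 < beta.
Hypothesis conc : forall la, \sum_(x | `|val x - la| <= 1) p x <= 1 - beta.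
Variables (N n : nat) (B : 'M[R]_(N, n)).

Definition shifted (f : {ffun 'I_N * 'I_n -> G}) : 'M[R]_(N, n) :=
  \matrix_(i, j) (val (f (i, j)) + B i j).

(** Two successive resamplings.  The first one fixes the columns outside [J], hence
the matrix [E] below and with it [I] and [M]; the second one fixes the entries in
[J] outside the rows [I].  The map [M] acts as the identity, up to low rank,
only on vectors supported by [I]; the fixed entries of [J] are therefore carried
along as the shift [M *m F]. *)
Lemma block_prob (J : {set 'I_n}) (kappa zeta tau x : R) (m L a b : nat) :
  0 < kappa -> (0 < N)%N -> (n <= N)%N -> kappa * N%:R <= (N - n)%:R ->
  4 * m%:R <= kappa * N%:R -> 128 * m%:R <= zeta * kappa ^+ 3 * N%:R ->
  (0 < m)%N -> 0 < x <= 1 -> b%:R <= beta / 96 * m%:R ->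
  128 * tau < kappa * beta * a.+1%:R ->
  #|J|%:R + zeta * m%:R + 1 <= L%:R ->
  Pr p (fun f => exists y, 0 < mass J y /\ nsq (shifted f *m y) <= tau * mass J y) <=
    96 / beta * (x ^- L * (1 + x) ^+ (4 * m) * ((9 / 4) ^+ a * (2 / 3) ^+ b)).
Proof.
move=> k0 N0 nN kN h4 h128 m0 x01 hb ha hL.
apply: (Pr_resample_le p_ge0 p_sum1 (S := fun t => t.2 \in J)) => f.
pose E : 'M[R]_(N, n) := \matrix_(i, j) if j \in J then 0 else shifted f i j.
have [I [l [M [U [W [cI hl ME Mx MI]]]]]] := dimension_reduction E k0 N0 nN kN h4 h128.
apply: (Pr_resample_le p_ge0 p_sum1 (S := fun t => (t.1 \in I) && (t.2 \in J))) => g.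
pose F : 'M[R]_(N, n) := \matrix_(i, j)
  if (j \in J) && (i \notin I) then val (g (i, j)) + B i j else 0.
have hbI : b%:R <= beta / 96 * #|I|%:R by rewrite cI.
have I0 : (0 < #|I|)%N by rewrite cI.
apply: le_trans (_ : 96 / beta * (x ^- (#|J| + (l + 1)) * (1 + x) ^+ (4 * #|I|) *
    ((9 / 4) ^+ a * (2 / 3) ^+ b)) <= _); last first.
  rewrite cI ler_pM2l ?divr_gt0 // ler_wpM2r ?mulr_ge0 ?exprn_ge0 //; try lra.
  case/andP: x01 => x0 x1; rewrite ler_wpM2r ?exprn_ge0 //; first lra.
  rewrite lef_pV2 ?posrE ?exprn_gt0 //; apply: ler_wiXn2l => //; first exact: ltW.
  by rewrite -(ler_nat R) !natrD; lra.
apply: le_trans (degenerate_prob p_ge0 p_sum1 beta_gt0 conc J (B + M *m F) (- U) a hbI x01 I0).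
apply: ler_Pr => // h [y [y0 hy]].
set D := shifted _ in hy.
pose DJ : 'M[R]_(N, n) := \matrix_(i, j) if j \in J then D i j else 0.
have eD : D = E + DJ.
  apply/matrixP => i j; rewrite !mxE; case: ifP => jJ; first by rewrite add0r.
  by rewrite addr0 !ffunE /= jJ.
have eF : DJ = mask R I *m DJ + F.
  apply/matrixP => i j; rewrite [RHS]mxE maskE !mxE.
  case: (boolP (i \in I)) => iI; rewrite ?mul1r ?mul0r ?andbF ?addr0 ?add0r //= ?andbT.
  by case: ifP => // jJ; rewrite !ffunE /= jJ (negPf iI).
have F0 i j : j \notin J -> (M *m F) i j = 0.
  by move=> jJ; rewrite mxE big1 // => i' _; rewrite [F _ _]mxE (negPf jJ) mulr0.
pose w := W *m (DJ *m y).
have res i : i \in I -> (M *m (D *m y)) i 0 = residual val J (B + M *m F) (- U) h i y w.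
  move=> iI.
  have -> : M *m (D *m y) = mask R I *m (DJ *m y) - U *m w + (M *m F) *m y.
    rewrite eD mulmxDl mulmxDr mulmxA ME mul0mx add0r {1}eF mulmxDl mulmxDr.
    by rewrite /w !mulmxA MI !mulmxBl.
  have addE (u v : 'cV[R]_N) : (u + v) i 0 = u i 0 + v i 0 by rewrite mxE.
  have oppE (u : 'cV[R]_N) : (- u) i 0 = - u i 0 by rewrite mxE.
  rewrite !addE oppE maskE iI mul1r /residual mulNmx oppE addrAC; congr (_ + _).
  rewrite [(DJ *m y) i 0]mxE [(M *m F *m y) i 0]mxE -big_split [RHS]big_mkcond.
  apply: eq_bigr => j _ /=.
  case: ifP => jJ; last by rewrite F0 ?jJ // mul0r [DJ _ _]mxE jJ mul0r addr0.
  rewrite [DJ _ _]mxE jJ !mxE !ffunE /= jJ iI /=.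
  by rewrite -mulrDl addrA.
exists y, w; split => //.
set Lr := large_rows _ _ _ _ _ _ _ _ _.
have c1 : #|Lr|%:R * (beta / 32 * mass J y) <= nsq (M *m (D *m y)).
  rewrite -sum1_card natr_sum mulr_suml nsqE [leRHS](bigID (mem Lr)) /=.
  rewrite -[leLHS]addr0; apply: lerD; last by apply: sumr_ge0 => i _; exact: sqr_ge0.
  apply: ler_sum => i iL; rewrite mul1r.
  by move: iL; rewrite inE => /andP[iI /ltW]; rewrite -res.
have c2 := Mx (D *m y).
rewrite -ltnS -(ltr_nat R).
have c3 : kappa / 4 * (#|Lr|%:R * (beta / 32 * mass J y)) <= tau * mass J y.
  by apply: le_trans hy; apply: le_trans c2; rewrite ler_pM2l //; lra.
have c4 : kappa / 4 * (#|Lr|%:R * (beta / 32)) <= tau.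
  by rewrite -(ler_pM2r y0); move: c3; rewrite !mulrA.
have kb : 0 < kappa * beta by rewrite mulr_gt0.
rewrite -(ltr_pM2l kb); apply: le_lt_trans ha.
rewrite (_ : kappa * beta * #|Lr|%:R = 128 * (kappa / 4 * (#|Lr|%:R * (beta / 32)))); last by field.
by rewrite ler_pM2l.
Qed.

End Block.

From mathcomp Require Import all_classical all_reals all_analysis.
From mathcomp Require Import measurable_realfun.
From mathcomp Require Import ring lra zify.

(** * Cutting the columns into blocks; choice of constants *)

(** Residue classes give blocks of nearly equal size that do not depend on y, so
that the union bound over blocks costs only the constant factor r. *)
Section Residues.
Variables (n r : nat).
Hypothesis r_gt0 : (0 < r)%N.

Definition residue_block (c : 'I_r) : {set 'I_n} := [set j : 'I_n | (j %% r)%N == c].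

Lemma card_residue_block c : (#|residue_block c| <= n %/ r + 1)%N.
Proof.
have lt (j : 'I_n) : (j %/ r < n %/ r + 1)%N.
  by rewrite addn1 ltnS leq_div2r // ltnW.
pose q (j : 'I_n) := Ordinal (lt j).
rewrite -[X in (_ <= X)%N]card_ord -(@card_in_imset _ _ q); first exact: max_card.
move=> j j'; rewrite !inE => /eqP e /eqP e' [eq]; apply/val_inj => /=.
by rewrite (divn_eq j r) (divn_eq j' r) e e' eq.
Qed.

Lemma heavy_residue_block (R : realType) (y : 'cV[R]_n) :
  exists c, nsq y <= r%:R * mass (residue_block c) y.
Proof.
have S0 : (0 < #|[set: 'I_r]|)%N by rewrite cardsT card_ord.
have [c _] := pigeonhole_avg (fun c => - mass (residue_block c) y) S0.
rewrite cardsT card_ord mulNr sumrN lerN2 mulrC => h; exists c; apply: le_trans h.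
rewrite le_eqVlt; apply/orP; left; apply/eqP.
pose cl (j : 'I_n) : 'I_r := Ordinal (ltn_pmod j r_gt0).
rewrite nsqE (partition_big cl xpredT) //=.
apply: eq_big => [i|i _]; first by rewrite inE.
by apply: eq_bigl => j; rewrite inE.
Qed.

End Residues.

Section Exponents.
Variable R : realType.

Lemma floor_nat (t : R) : 0 <= t -> exists a : nat, a%:R <= t < a.+1%:R.
Proof. by move=> t0; exists (Num.truncn t); exact: truncn_itv. Qed.

Lemma nat_above (t : R) : exists a : nat, t <= a%:R.
Proof.
have [t0|t0] := ltP t 0; first by exists 0; rewrite ltW.
by have [a /andP[_ h]] := floor_nat t0; exists a.+1; rewrite ltW.
Qed.

(** In units of [h * m], with [lam = ln (3 / 2)]: the two factors of the pattern
count cost 1/4 each, (9/4)^a costs 1, and (2/3)^b gains 2 up to the rounding of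
[b], which is the factor [expR lam]. *)
Lemma exponent_bound (lam l x h z : R) (L m a b : nat) :
  0 < h -> expR (- l) = x -> 0 <= l -> 0 < lam -> expR lam = 3 / 2 ->
  z * l <= h / 8 -> x <= h / 16 -> L%:R <= 2 * z * m%:R ->
  lam * a%:R <= h / 2 * m%:R -> 2 * h * m%:R <= lam * b.+1%:R ->
  x ^- L * (1 + x) ^+ (4 * m) * ((9 / 4) ^+ a * (2 / 3) ^+ b) <=
    expR lam * expR (- (h / 2 * m%:R)).
Proof.
move=> h0 ex l0 lam0 elam zl xh Lz la lb.
have x0 : 0 < x by rewrite -ex expR_gt0.
have m0 : 0 <= m%:R :> R by rewrite ler0n.
have e1 : x ^- L = expR (L%:R * l).
  by rewrite -ex -expRM_natr -expRN mulNr opprK mulrC.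
have e2 : (1 + x) ^+ (4 * m) <= expR (4 * m%:R * x).
  apply: (@le_trans _ _ (expR x ^+ (4 * m))).
    by apply: lerXn2r; rewrite ?nnegrE ?expR_ge0 ?expR_ge1Dx //; lra.
  by rewrite -expRM_natr natrM mulrC.
have e3 : (9 / 4) ^+ a = expR (2 * (lam * a%:R)).
  rewrite (_ : 9 / 4 = expR (lam * 2%:R)); last first.
    by rewrite expRM_natr elam; field.
  by rewrite -expRM_natr; congr expR; ring.
have e4 : (2 / 3) ^+ b = expR (- (lam * b%:R)).
  rewrite (_ : 2 / 3 = expR (- lam)); last by rewrite expRN elam; field.
  by rewrite -expRM_natr mulNr.
rewrite e1 e3 e4 -!expRD.
apply: (@le_trans _ _ (expR (L%:R * l) * expR (4 * m%:R * x) *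
   expR (2 * (lam * a%:R) - lam * b%:R))).
  by rewrite ler_pM2r ?expR_gt0 // ler_pM2l ?expR_gt0.
rewrite -!expRD ler_expR.
have h1 : L%:R * l <= h / 4 * m%:R.
  apply: (@le_trans _ _ (2 * z * m%:R * l)); first exact: ler_wpM2r.
  by have := ler_wpM2r m0 zl; lra.
have h2 : 4 * m%:R * x <= h / 4 * m%:R by have := ler_wpM2r m0 xh; lra.
move: lb; rewrite -[b.+1]addn1 natrD mulrDr mulr1 => lb.
by lra.
Qed.

(** The order of the choices matters: [h] is the exponential rate per row of [I];
then [l], the logarithm of 1/x, is chosen so that (1 + x)^(4m) is harmless; then
[zeta], so that x^(-L) is harmless for L <= 2 zeta m; then [mu], the proportion
of rows in [I]; then the number [r] of blocks and the bound [u] on the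
squared norm; and last [N0]. *)
Lemma choice_of_constants (beta kappa : R) : 0 < beta -> 0 < kappa ->
  exists (lam l h zeta mu u v : R) (r : nat) (N0 : nat),
   [/\ 0 < u, 0 < v, 0 < mu, 0 < zeta & (0 < r)%N] /\
   [/\ 0 < h, 0 <= l, 0 < lam, expR lam = 3 / 2 & 192 * h = lam * beta] /\
   [/\ zeta * l <= h / 8, expR (- l) <= h / 16, 4 * mu <= kappa, 128 * mu <= zeta * kappa ^+ 3 &
      128 * (r%:R * u) * 768 < kappa * beta ^+ 2 * mu] /\
   (forall N : nat, (N0 <= N)%N ->
     [/\ 2 <= mu * N%:R, N%:R / r%:R + 3 <= zeta * mu / 2 * N%:R &
     r%:R * (96 / beta) * expR lam * expR (- (h / 2 * (mu / 2 * N%:R))) <= expR (- (v * N%:R))]).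
Proof.
move=> b0 k0.
pose lam : R := ln (3 / 2).
have lam0 : 0 < lam by apply: ln_gt0; lra.
have elam : expR lam = 3 / 2 by rewrite lnK // posrE; lra.
pose h := lam * beta / 192.
have h0 : 0 < h by have := mulr_gt0 lam0 b0; rewrite /h; lra.
pose x := h / (16 * (1 + h)).
have x0 : 0 < x by rewrite divr_gt0 // mulr_gt0 //; lra.
have xh : x <= h / 16.
  by rewrite ler_pM2l // lef_pV2 ?posrE //; lra.
have x1 : x <= 1 by rewrite ler_pdivrMr; lra.
pose l := - ln x.
have l0 : 0 <= l by rewrite oppr_ge0 ln_le0.
have ex : expR (- l) = x by rewrite opprK lnK.
pose zeta := h / (8 * (1 + l)).
have z0 : 0 < zeta by rewrite divr_gt0 // mulr_gt0 //; lra.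
have zl : zeta * l <= h / 8.
  have -> : zeta * l = h / 8 * (l / (1 + l)) by rewrite /zeta; field; rewrite gt_eqF //; lra.
  have h8 : 0 <= h / 8 by lra.
  apply: ler_piMr => //; rewrite ler_pdivrMr; lra.
pose mu := Num.min (kappa / 4) (zeta * kappa ^+ 3 / 128).
have zk : 0 < zeta * kappa ^+ 3 by rewrite mulr_gt0 // exprn_gt0.
have mu0 : 0 < mu by rewrite lt_min; apply/andP; split; lra.
have mu1 : mu <= kappa / 4 by rewrite ge_min lexx.
have mu2 : mu <= zeta * kappa ^+ 3 / 128 by rewrite ge_min lexx orbT.
have zm : 0 < zeta * mu by rewrite mulr_gt0.
have [r0 hr0] := nat_above (4 / (zeta * mu)).
pose r := r0.+1.
have r1 : 0 < r%:R :> R by rewrite ltr0n.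
have hr : r%:R ^-1 <= zeta * mu / 4.
  rewrite -[leRHS]invrK lef_pV2 ?posrE ?invr_gt0 //; last lra.
  by rewrite invf_div; apply: le_trans hr0 _; rewrite ler_nat.
pose u := kappa * beta ^+ 2 * mu / 128 / 768 / 2 / r%:R.
have K0 : 0 < kappa * beta ^+ 2 * mu by rewrite !mulr_gt0 // exprn_gt0.
have u0 : 0 < u by apply: divr_gt0 r1; move: K0; clear; lra.
pose v := h * mu / 8.
have v0 : 0 < v by rewrite divr_gt0 // mulr_gt0.
pose C := r%:R * (96 / beta) * expR lam.
have C0 : 0 < C by rewrite !mulr_gt0 ?expR_gt0 ?invr_gt0 //.
have [N1 hN1] := nat_above (2 / mu).
have [N2 hN2] := nat_above (12 / (zeta * mu)).
have [N3 hN3] := nat_above (ln C / v).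
exists lam, l, h, zeta, mu, u, v, r, (maxn N1 (maxn N2 N3)).
split; first by split.
split; first by split => //; rewrite /h; field.
split.
  split => //; [by rewrite ex | lra | lra |].
  rewrite /u (_ : 128 * _ * 768 = kappa * beta ^+ 2 * mu / 2); first by move: K0; clear; lra.
  by field; rewrite gt_eqF.
move=> N; rewrite !geq_max => /andP[l1 /andP[l2 l3]].
have {hN1} hN1 : 2 / mu <= N%:R by apply: le_trans hN1 _; rewrite ler_nat.
have {hN2} hN2 : 12 / (zeta * mu) <= N%:R by apply: le_trans hN2 _; rewrite ler_nat.
have {hN3} hN3 : ln C / v <= N%:R by apply: le_trans hN3 _; rewrite ler_nat.
split.
- by move: hN1; rewrite ler_pdivrMr // mulrC.
- move: hN2; rewrite ler_pdivrMr // => hN2.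
  have := ler_wpM2l (ler0n R N) hr; move: hN2; clear.
  by move: (N%:R / r%:R : R) (zeta * mu) (N%:R : R) => q s t; lra.
rewrite -/C -[C]lnK // -expRD ler_expR.
move: hN3; rewrite ler_pdivrMr // /v; clear.
by move: (ln C) (N%:R : R) (h) (mu) => c t h1 mu3; lra.
Qed.

End Exponents.

(** * The theorem for finitely valued entries *)

(** Squared norms are compared, so [u] is the square of the constant multiplying
sqrt N. *)
Lemma discrete_smallest_singular (R : realType) (beta delta : R) : 0 < beta -> 1 < delta ->
  exists (u v : R) (N0 : nat), [/\ 0 < u, 0 < v &
   forall N n : nat, (N0 <= N)%N -> delta * n%:R <= N%:R ->
   forall (G : finType) (p val : G -> R),
     (forall x, 0 <= p x) -> \sum_x p x = 1 ->
     (forall la, \sum_(x | `|val x - la| <= 1) p x <= 1 - beta) ->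
   forall B : 'M[R]_(N, n),
     Pr p (fun f => exists y, 0 < nsq y /\ nsq (shifted val B f *m y) <= u * N%:R * nsq y)
       <= expR (- (v * N%:R))].
Proof.
move=> b0 d1.
have d0 : 0 < delta by lra.
pose kappa := 1 - delta^-1.
have k0 : 0 < kappa by rewrite subr_gt0 invf_lt1.
have [lam [l [h [zeta [mu [u [v [r [N0 H]]]]]]]]] := choice_of_constants b0 k0.
move: H => [[u0 v0 mu0 z0 r0] [[h0 l0 lam0 elam hlam] [[zl xh mk mz ur] big]]].
exists u, v, N0; split => // N n NN dn G p val p0 p1 conc B.
have [N2 Nr final] := big N NN.
have N_gt0 : (0 < N)%N.
  by rewrite lt0n; apply: contraTneq N2 => ->; rewrite mulr0 -ltNge ltr0n.
have Npos : 0 < N%:R :> R by rewrite ltr0n.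
have n0 : 0 <= n%:R :> R by rewrite ler0n.
have nN : n%:R <= N%:R :> R by apply: le_trans dn; rewrite ler_peMl // ltW.
have {}nN : (n <= N)%N by rewrite -(ler_nat R).
have kN : kappa * N%:R <= (N - n)%:R.
  rewrite natrB // mulrBl mul1r lerD2l lerN2 mulrC ler_pdivlMr //.
  by rewrite mulrC.
have [m /andP[m1 m2]] := @floor_nat R (mu * N%:R) (mulr_ge0 (ltW mu0) (ler0n _ _)).
have m2' : mu * N%:R < m%:R + 1 by rewrite natr1.
have hm : mu / 2 * N%:R <= m%:R by move: N2 m2'; clear; lra.
have m0 : 0 < m%:R :> R by move: N2 hm; clear; lra.
have [|a /andP[a1 a2]] := @floor_nat R (beta / 384 * m%:R).
  exact: mulr_ge0 (divr_ge0 (ltW b0) (ler0n _ _)) (ltW m0).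
have [|b /andP[c1 c2]] := @floor_nat R (beta / 96 * m%:R).
  exact: mulr_ge0 (divr_ge0 (ltW b0) (ler0n _ _)) (ltW m0).
have [t /andP[t1 t2]] := @floor_nat R (zeta * m%:R) (mulr_ge0 (ltW z0) (ltW m0)).
have rpos : 0 < r%:R :> R by rewrite ltr0n.
set x := expR (- l) in xh.
have x01 : 0 < x <= 1 by rewrite expR_gt0 /= /x -[leRHS]expR0 ler_expR oppr_le0.
pose L := (n %/ r + 1 + t + 2)%N.
have nr : (n %/ r)%:R <= N%:R / r%:R :> R.
  rewrite ler_pdivlMr // -natrM ler_nat; exact: leq_trans (leq_divM _ _) nN.
have LE : L%:R = (n %/ r)%:R + 1 + t%:R + 2 :> R by rewrite /L !natrD.
have L2 : L%:R <= 2 * zeta * m%:R.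
  have hz := ler_wpM2l (ltW z0) hm.
  by rewrite LE; move: hz nr Nr t1; clear; move: (N%:R / r%:R) => q; lra.
apply: (@le_trans _ _ (\sum_(c < r) Pr p (fun f => exists y,
    0 < mass (residue_block n c) y /\
    nsq (shifted val B f *m y) <= r%:R * u * N%:R * mass (residue_block n c) y))).
  apply: le_trans (Pr_exists p0 _); apply: ler_Pr => // f [y [y0 hy]].
  have [c hc] := heavy_residue_block r0 y; exists c, y.
  have mc : 0 < mass (residue_block n c) y by rewrite -(pmulr_rgt0 _ rpos); exact: lt_le_trans hc.
  split=> //; apply: le_trans hy _.
  rewrite (_ : _ * u * _ * _ = u * N%:R * (r%:R * mass (residue_block n c) y)); last by ring.
  by apply: ler_wpM2l hc; rewrite mulr_ge0 // ltW.
apply: (@le_trans _ _ (\sum_(c < r) 96 / beta * (expR lam * expR (- (h / 2 * m%:R))))).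
  apply: ler_sum => c _.
  apply: le_trans (@block_prob _ _ p val beta p0 p1 b0 conc N n B (residue_block n c)
    kappa zeta _ x m L a b k0 N_gt0 nN kN _ _ _ x01 c1 _ _) _.
  - have := ler_wpM2r (ltW Npos) mk; move: m1; clear; lra.
  - have := ler_wpM2r (ltW Npos) mz; move: m1; clear.
    by move: (kappa ^+ 3) => k3; lra.
  - by rewrite -(ltr_nat R).
  - have kb : 0 < kappa * beta by rewrite mulr_gt0.
    have e1 : 128 * (r%:R * u) * 768 * N%:R < kappa * beta ^+ 2 * mu * N%:R by rewrite ltr_pM2r.
    have e2 : kappa * beta * (beta * (mu / 2 * N%:R)) <= kappa * beta * (beta * m%:R).
      by rewrite ler_pM2l // ler_pM2l.
    have e3 : kappa * beta * (beta / 384 * m%:R) < kappa * beta * a.+1%:R by rewrite ltr_pM2l.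
    move: e1 e2 e3; rewrite expr2; clear.
    by move: (a.+1%:R : R) (N%:R : R) (r%:R : R) (m%:R : R) => A' N' r' m'; lra.
  - have cJ : #|residue_block n c|%:R <= (n %/ r)%:R + 1 :> R.
      by rewrite natr1 ler_nat -addn1 card_residue_block.
    rewrite LE; move: cJ t2; rewrite -[t.+1]addn1 natrD; clear.
    by move: (#|_|%:R : R) ((n %/ r)%:R : R) => J' q; lra.
  rewrite ler_pM2l ?divr_gt0 //.
  apply: (@exponent_bound _ lam l x h zeta L m a b) => //.
  - have := ler_wpM2l (ltW lam0) a1; move: hlam; clear.
    move: (a%:R : R) (m%:R : R) => A' M' e; nra.
  - have := ler_wpM2l (ltW lam0) (ltW c2); move: hlam; clear.
    by move: (b.+1%:R : R) (m%:R : R) => A' M' e; nra.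
rewrite sumr_const card_ord -[leLHS]mulr_natl.
apply: le_trans final; rewrite -!mulrA ler_pM2l // ler_pM2l // ler_pM2l ?invr_gt0 //.
rewrite ler_pM2l ?expR_gt0 //.
by rewrite ler_expR lerN2; apply: ler_wpM2l => //; lra.
Qed.

Import numFieldNormedType.Exports.
Local Open Scope classical_set_scope.

(** * The smallest singular value as a function of the matrix *)

Section SmallestSingular.
Variable R : realType.

Lemma enormE n (x : 'cV[R]_n) : enorm x = Num.sqrt (nsq x).
Proof. by rewrite nsqE. Qed.

Lemma esphereP n (y : 'cV[R]_n) : esphere y <-> nsq y = 1.
Proof.
rewrite /esphere /= enormE; split => [h|->]; last by rewrite sqrtr1.
by rewrite -[LHS]sqr_sqrtr ?nsq_ge0 // h expr1n.
Qed.

Definition frob N n (D : 'M[R]_(N, n)) : R := \sum_i \sum_j D i j ^+ 2.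

Lemma frob_ge0 N n (D : 'M[R]_(N, n)) : 0 <= frob D.
Proof. by do 2!(apply: sumr_ge0 => ? _); exact: sqr_ge0. Qed.

Lemma nsq_mul_le N n (D : 'M[R]_(N, n)) y : nsq (D *m y) <= frob D * nsq y.
Proof.
rewrite nsqE mulr_suml; apply: ler_sum => i _.
have -> : (D *m y) i 0 = dot (row i D)^T y.
  by rewrite dotE mxE; apply: eq_bigr => j _; rewrite !mxE.
have -> : \sum_j D i j ^+ 2 = nsq (row i D)^T.
  by rewrite nsqE; apply: eq_bigr => j _; rewrite !mxE.
exact: cauchy_schwarz.
Qed.

Lemma nsqD_le N (u v : 'cV[R]_N) : nsq (u + v) <= 2 * nsq u + 2 * nsq v.
Proof.
by have := nsq_ge0 (u - v); rewrite nsqB nsqD; lra.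
Qed.

(** The strict inequality between quadratic forms is open and homogeneous, hence it
passes from y to the integer parts of K y for K large.  This turns the
uncountable infimum over the sphere into a countable one. *)
Lemma integer_witness N n (D : 'M[R]_(N, n)) (y : 'cV[R]_n) (r : R) : 0 <= r ->
  nsq (D *m y) < r * nsq y ->
  exists z : 'cV[int]_n, nsq (D *m map_mx intr z) < r * nsq (map_mx intr z).
Proof.
move=> r0 lt.
pose gap := r * nsq y - nsq (D *m y).
have gap0 : 0 < gap by rewrite subr_gt0.
pose F := frob D.
have F0 : 0 <= F := frob_ge0 D.
pose c := (r + F) * (nsq y + n%:R).
have c0 : 0 <= c by rewrite mulr_ge0 ?addr_ge0 ?nsq_ge0.
have [K hK] := nat_above (2 * (c + 1) / gap + 1).
pose Kr : R := K%:R.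
have K1 : 1 <= Kr.
  apply: le_trans hK; rewrite lerDr divr_ge0 ?(ltW gap0) //; lra.
have Kgap : 2 * (c + 1) < Kr * gap.
  have : 2 * (c + 1) / gap < Kr by apply: lt_le_trans hK; rewrite ltrDl.
  by rewrite ltr_pdivrMr.
pose z : 'cV[int]_n := \col_i Num.floor (Kr * y i 0).
exists z; set zr := map_mx _ z.
pose e := Kr *: y - zr.
have nsqe : nsq e <= n%:R.
  rewrite nsqE -[n in leRHS]card_ord -sumr_const; apply: ler_sum => i _.
  rewrite !mxE; have /andP[h1 h2] := floor_itv (Kr * y i 0).
  by rewrite expr_le1 //; rewrite ?subr_ge0 // lerBlDl; move: h2; rewrite intrD; lra.
have -> : zr = Kr *: y - e by rewrite /e opprB addrC subrK.
clearbody e.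
have cross N' (u v : 'cV[R]_N') : - (nsq u + nsq v) <= 2 * dot u v <= nsq u + nsq v.
  have := nsq_ge0 (u - v); have := nsq_ge0 (u + v).
  rewrite nsqB nsqD.
  by move=> h1 h2; apply/andP; split; lra.
rewrite mulmxBr -scalemxAr !nsqB !nsqZ !dotZl.
have /andP[_ h1] := cross _ y e.
have /andP[h2 _] := cross _ (D *m y) (D *m e).
have h3 := nsq_mul_le D y; have h4 := nsq_mul_le D e.
have h5 : F * nsq e <= F * n%:R by apply: ler_wpM2l.
have h6 : r * (2 * dot y e) <= r * (nsq y + nsq e) by apply: ler_wpM2l.
have h7 : r * nsq e <= r * n%:R by apply: ler_wpM2l.
have h8 := nsq_ge0 e.
have h9 : 0 <= r * nsq e by rewrite mulr_ge0.
have rn : 0 <= r * n%:R by rewrite mulr_ge0.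
have rY : 0 <= r * nsq y by rewrite mulr_ge0 ?nsq_ge0.
have FY : 0 <= F * nsq y by rewrite mulr_ge0 ?nsq_ge0.
have ce : c = r * nsq y + r * n%:R + F * nsq y + F * n%:R by rewrite /c; ring.
have low : - c <= 2 * dot (D *m y) (D *m e) - r * (2 * dot y e) by rewrite ce -/F in h3 h4 *; lra.
have h10 : nsq (D *m e) <= c by rewrite ce -/F in h4 *; lra.
have h11 : Kr * - c <= Kr * (2 * dot (D *m y) (D *m e) - r * (2 * dot y e)).
  by apply: ler_wpM2l => //; lra.
have h12 : Kr * (2 * (c + 1)) < Kr * (Kr * gap) by rewrite ltr_pM2l //; lra.
have h13 : c <= Kr * c by rewrite ler_peMl.
rewrite -subr_gt0.
rewrite [X in 0 < X](_ : _ = Kr * (Kr * gap) + Kr * (2 * dot (D *m y) (D *m e) - r * (2 * dot y e))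
   + r * nsq e - nsq (D *m e)); last by rewrite /gap; ring.
have h14 : Kr * (2 * (c + 1)) = 2 * (Kr * c) + 2 * Kr by ring.
have h15 : Kr * - c = - (Kr * c) by ring.
rewrite h14 in h12; rewrite h15 in h11.
move: h9 h10 h11 h12 h13 K1; clear.
set t2 := Kr * (_ - _); set t1 := Kr * (Kr * _); set t3 := r * _; set t4 := nsq _; set t5 := Kr * c.
by move: t1 t2 t3 t4 t5 (Kr) (c) => t1 t2 t3 t4 t5 k c'; lra.
Qed.

End SmallestSingular.

(** * Measurability and finitely valued observables *)

Section Measurability.
Variable R : realType.

(** The set of values is not empty because n is positive, so the infimum is
approached. *)
Lemma smallest_singular_near_min N n (D : 'M[R]_(N, n)) (c c' : R) : (0 < n)%N ->
  0 <= c -> smallest_singular D <= c -> c < c' -> exists2 y, nsq y = 1 & nsq (D *m y) < c' ^+ 2.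
Proof.
move=> n0 c0 sc cc.
have [|x [y /esphereP y1 <-] hx] :=
  @inf_lt R [set enorm (D *m y) | y in @esphere R n] c' _ (le_lt_trans sc cc).
  pose y : 'cV[R]_n := \col_i (i == Ordinal n0)%:R.
  exists (enorm (D *m y)); exists y => //; apply/esphereP.
  rewrite nsqE (bigD1 (Ordinal n0)) //= big1 ?addr0 => [|i /negPf ni].
    by rewrite mxE eqxx expr1n.
  by rewrite mxE ni expr0n.
exists y => //; have c'0 : 0 <= c' by lra.
by rewrite -(sqr_sqrtr (nsq_ge0 (D *m y))) ltr_sqr ?nnegrE ?sqrtr_ge0 // -enormE.
Qed.

Lemma smallest_singular_leP N n (D : 'M[R]_(N, n)) (c : R) : (0 < n)%N -> 0 <= c ->
  smallest_singular D <= c <->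
  forall k : nat, exists z : 'cV[int]_n,
    nsq (D *m map_mx intr z) < (c + k.+1%:R^-1) ^+ 2 * nsq (map_mx intr z).
Proof.
move=> n0 c0; split=> [sc k|h].
  have k0 : 0 < k.+1%:R^-1 :> R by rewrite invr_gt0 ltr0n.
  have [|y y1 hy] := smallest_singular_near_min (c' := c + k.+1%:R^-1) n0 c0 sc.
    by rewrite ltrDl.
  by apply: (@integer_witness _ _ _ _ y); rewrite ?sqr_ge0 // y1 mulr1.
apply/ler_addgt0Pr => e e0.
have [k hk] := nat_above e^-1.
have ke : k.+1%:R^-1 <= e.
  by rewrite -[e]invrK lef_pV2 ?posrE ?invr_gt0 ?ltr0n // (le_trans hk) // ler_nat.
have [z hz] := h k; set y := map_mx _ z in hz.
have k0 : 0 < k.+1%:R^-1 :> R by rewrite invr_gt0 ltr0n.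
have y0 : 0 < nsq y.
  rewrite lt_neqAle nsq_ge0 andbT eq_sym; apply: contraTneq hz => ->.
  by rewrite mulr0 -leNgt nsq_ge0.
pose a := (Num.sqrt (nsq y))^-1.
have a2 : a ^+ 2 * nsq y = 1 by rewrite exprVn sqr_sqrtr ?nsq_ge0 // mulVf // gt_eqF.
apply: (@le_trans _ _ (enorm (D *m (a *: y)))).
  apply: ge_inf; first by exists 0 => _ [x _ <-]; rewrite enormE sqrtr_ge0.
  by exists (a *: y) => //; apply/esphereP; rewrite nsqZ.
rewrite enormE -scalemxAr nsqZ.
have ce : 0 <= c + k.+1%:R^-1 by rewrite addr_ge0 // ltW.
apply: (@le_trans _ _ (c + k.+1%:R^-1)); last by rewrite lerD2l.
rewrite -[leRHS](ger0_norm ce) -sqrtr_sqr; apply: ler_wsqrtr.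
move: (c + _) hz => c1 hz; rewrite -[leRHS]mulr1 -a2 mulrCA.
by rewrite ler_wpM2l ?sqr_ge0 // ltW.
Qed.

Lemma measurable_lt_set (d : measure_display) (T : measurableType d) (f g : T -> R) :
  measurable_fun setT f -> measurable_fun setT g -> measurable [set w | f w < g w].
Proof.
move=> mf mg; rewrite -[X in measurable X]setTI.
by have /(_ measurableT [set true]) := measurable_fun_ltr mf mg; apply.
Qed.

Lemma measurable_norm_gt (d : measure_display) (T : measurableType d) (f : T -> R) (M : R) :
  measurable_fun setT f -> measurable [set w | M < `|f w|].
Proof.
by move=> mf; apply: measurable_lt_set (measurable_cst _) _; exact: measurableT_comp.
Qed.

Variables (d : measure_display) (T : measurableType d).

Lemma measurable_smallest_singular N n (D : T -> 'M[R]_(N, n)) (c : R) : (0 < n)%N -> 0 <= c ->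
  (forall i j, measurable_fun setT (fun w => D w i j)) ->
  measurable [set w | smallest_singular (D w) <= c].
Proof.
move=> n0 c0 mD.
have -> : [set w | smallest_singular (D w) <= c] = \bigcap_(k in [set: nat])
   \bigcup_(z in [set: 'cV[int]_n]) [set w | nsq (D w *m map_mx intr z) <
       (c + k.+1%:R^-1) ^+ 2 * nsq (map_mx intr z : 'cV[R]_n)].
  apply/seteqP; split=> w /=.
    by move/(smallest_singular_leP _ n0 c0) => h k _; have [z hz] := h k; exists z.
  by move=> h; apply/(smallest_singular_leP _ n0 c0) => k; have [z _ hz] := h k I; exists z.
apply: bigcapT_measurable => k.
apply: countable_bigcupT_measurable => [|z]; first exact: countableP.
apply: measurable_lt_set (measurable_cst _).
under eq_fun do rewrite nsqE.
apply: measurable_sum => i; apply: measurable_funX.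
under eq_fun do rewrite mxE.
by apply: measurable_sum => j; apply: measurable_funM => //; exact: measurable_cst.
Qed.

Variable P : probability T R.

Lemma measure_bigsetU_le (I : Type) (s : seq I) (C : I -> set T) :
  (forall x, measurable (C x)) ->
  (P (\big[setU/set0]_(x <- s) C x) <= \sum_(x <- s) P (C x))%E.
Proof.
move=> mC; elim: s => [|x s IH]; first by rewrite !big_nil measure0.
rewrite !big_cons; apply: le_trans (measureU2 _ _ _) _ => //.
  by apply: bigsetU_measurable => i _.
by apply: leeD2l.
Qed.

Section Discrete.
Variables (G : finType) (q : T -> G).
Hypothesis mq : forall x, measurable (q @^-1` [set x]).

Let mem_cons x (s : seq G) :
  [set w | q w \in x :: s] = q @^-1` [set x] `|` [set w | q w \in s].
Proof.
apply/seteqP; split => w /=; rewrite inE.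
  by case/orP => [/eqP|]; [left|right].
by case=> [->|->]; rewrite ?eqxx ?orbT.
Qed.

Let measurable_mem (s : seq G) : measurable [set w | q w \in s].
Proof.
elim: s => [|x s IH]; last by rewrite mem_cons; exact: measurableU.
by rewrite (_ : [set w | _] = set0) //; apply/seteqP; split.
Qed.

Let pred_mem (F : pred G) : [set w | F (q w)] = [set w | q w \in seq.filter F (index_enum G)].
Proof. by apply/seteqP; split => w /=; rewrite mem_filter mem_index_enum andbT. Qed.

Lemma measurable_discrete (F : pred G) : measurable [set w | F (q w)].
Proof. by rewrite pred_mem. Qed.

Lemma measure_discrete (F : pred G) :
  P [set w | F (q w)] = (\sum_(x | F x) P (q @^-1` [set x]))%E.
Proof.
rewrite pred_mem -big_filter.
have : uniq (seq.filter F (index_enum G)) by rewrite filter_uniq // index_enum_uniq.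
elim: (seq.filter _ _) => [_|x s IH /= /andP[xs us]].
  by rewrite big_nil (_ : [set w | _] = set0) ?measure0 //; apply/seteqP; split.
rewrite mem_cons big_cons -IH // measureU //.
by apply/seteqP; split => // w /= [->]; rewrite (negPf xs).
Qed.

End Discrete.

Lemma tightness (X : {RV P >-> R}) (eps : R) : 0 < eps ->
  exists M : R, (P [set w | (M < `|X w|)%R] <= eps%:E)%E.
Proof.
move=> e0.
pose F (k : nat) := [set w | k%:R < `|X w|].
have mF k : measurable (F k) by exact: measurable_norm_gt.
have F0 : \bigcap_k F k = set0.
  apply/seteqP; split => // w h.
  have [k hk] := nat_above `|X w|.
  by have := h k I; rewrite /F /= ltNge hk.
case: (pselect (exists k, (P (F k) <= eps%:E)%E)) => [[k hk]|h]; first by exists k%:R.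
have cv : (P \o F) x @[x --> \oo] --> P (\bigcap_k F k).
  apply: nonincreasing_cvg_mu => //.
  - by apply: le_lt_trans (probability_le1 _ _) _ => //; rewrite ltry.
  - by rewrite F0.
  - move=> k m km; apply/subsetPset => w /=; apply: le_lt_trans.
    by rewrite ler_nat.
have : (eps%:E <= P (\bigcap_k F k))%E.
  apply: cvge_ge cv; apply: nearW => k /=.
  by rewrite leNgt; apply/negP => /ltW hk; apply: h; exists k.
by rewrite F0 measure0 lee_fin leNgt e0.
Qed.

End Measurability.

(** * Passage to finitely valued entries *)

(** [q a] records which points of a grid of mesh [eta] are below [a].  Two points
with the same record are at distance at most [eta], provided one of them lies
within the grid. *)
Lemma fine_discretization (R : realType) (M eta : R) : 0 < eta ->
  exists (G : finType) (q : R -> G), (forall x, measurable (q @^-1` [set x])) /\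
    forall a b, `|a| <= M -> q a = q b -> `|a - b| <= eta.
Proof.
move=> e0.
have [K hK] := nat_above (2 * M / eta + 2).
pose th (i : 'I_K) : R := - M + i%:R * eta.
pose q (a : R) : {set 'I_K} := finset (fun i => th i <= a).
exists {set 'I_K}, q; split=> [x|a b aM qab].
  have -> : q @^-1` [set x] = \bigcap_(i in [set: 'I_K]) [set a | (th i <= a) = (i \in x)].
    apply/seteqP; split => a /=; first by move=> <- i _ /=; rewrite inE.
    by move=> h; apply/setP => i; rewrite inE; exact: h.
  apply: fin_bigcap_measurable => // i _.
  case: (i \in x).
    rewrite (_ : [set a | _] = `[th i, +oo[%classic); first exact: measurable_itv.
    by apply/seteqP; split => a /=; rewrite in_itv /= andbT.
  rewrite (_ : [set a | _] = `]-oo, th i[%classic); first exact: measurable_itv.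
  by apply/seteqP; split => a /=; rewrite in_itv /= ltNge; [move=> -> | move/negbTE].
have /andP[a1 a2] : - M <= a <= M by rewrite -ler_norml.
have t0 : 0 <= (a + M) / eta by rewrite divr_ge0 ?(ltW e0) //; lra.
have [i /andP[i1 i2]] := floor_nat t0.
have iK : (i.+1 < K)%N.
  rewrite -(ltr_nat R); apply: lt_le_trans hK.
  have : (a + M) / eta <= 2 * M / eta by rewrite ler_pM2r ?invr_gt0 //; lra.
  by rewrite -[i.+1]addn1 natrD; lra.
have mem (j : 'I_K) : (th j <= a) = (th j <= b).
  by move/setP: qab => /(_ j); rewrite !inE.
rewrite ler_pdivlMr // in i1; rewrite ltr_pdivrMr // in i2.
have b1 : th (Ordinal (ltnW iK)) <= b by rewrite -mem /th /=; lra.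
have b2 : b < th (Ordinal iK) by rewrite ltNge -mem -ltNge /th /=; lra.
move: b1 b2; rewrite /th /= => b1 b2; move: i2 b2; rewrite -[i.+1]addn1 natrD mulrDl mul1r => i2 b2.
by rewrite ler_norml; apply/andP; split; lra.
Qed.

Section Transfer.
Variables (R : realType) (d : measure_display) (T : measurableType d) (P : probability T R).

Lemma concentration_ge (xi : {RV P >-> R}) alpha lambda :
  (P [set w | (`|xi w - lambda| <= alpha)%R] <= concentration xi alpha)%E.
Proof. by apply: ereal_sup_ubound; exists lambda. Qed.

Section Discretized.
Variables (N n : nat) (A : 'I_N -> 'I_n -> {RV P >-> R}).
Hypothesis iid : iid_entries A.
Variables (G : finType) (q : R -> G).
Hypothesis mq : forall x, measurable (q @^-1` [set x]).
Variables (i0 : 'I_N) (j0 : 'I_n).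

Let mQ (X : {RV P >-> R}) x : measurable ((fun w => q (X w)) @^-1` [set x]).
Proof. exact: (measurable_funPTI X (mq x)). Qed.

Definition cell_prob (x : G) : R := fine (P ((fun w => q (A i0 j0 w)) @^-1` [set x])).

Lemma cell_probE x : (cell_prob x)%:E = P ((fun w => q (A i0 j0 w)) @^-1` [set x]).
Proof. by rewrite fineK // fin_num_measure. Qed.

Lemma cell_prob_ge0 x : 0 <= cell_prob x.
Proof. by rewrite fine_ge0. Qed.

Lemma cell_prob_sum (F : pred G) :
  (\sum_(x | F x) cell_prob x)%:E = P [set w | F (q (A i0 j0 w))].
Proof.
rewrite -sumEFin (measure_discrete P (q := fun w => q (A i0 j0 w))) //.
by apply: eq_bigr => x _; exact: cell_probE.
Qed.

Lemma cell_prob_sum1 : \sum_x cell_prob x = 1.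
Proof.
apply/EFin_inj; rewrite cell_prob_sum -[RHS](probability_setT P); congr (P _).
by apply/seteqP; split.
Qed.

Definition joint_cell (f : {ffun 'I_N * 'I_n -> G}) : set T :=
  \bigcap_(ij in [set` [set: 'I_N * 'I_n]%SET]) (A ij.1 ij.2 @^-1` (q @^-1` [set f ij])).

Lemma measurable_joint_cell f : measurable (joint_cell f).
Proof. by apply: fin_bigcap_measurable => // ij _; exact: measurable_funPTI. Qed.

(** Independence gives the product, equality of the laws a single [cell_prob]. *)
Lemma joint_cell_prob f : P (joint_cell f) = (weight cell_prob f)%:E.
Proof.
have [ind idd] := iid.
rewrite (ind [set: 'I_N * 'I_n]%SET (fun ij => q @^-1` [set f ij])) //.
rewrite /weight -prodEFin; apply: eq_big => [ij|ij _]; first by rewrite inE.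
by rewrite cell_probE; exact: (idd ij (i0, j0) _ (mq (f ij))).
Qed.

Lemma tail_prob M ij : P [set w | (M < `|A ij.1 ij.2 w|)%R] = P [set w | (M < `|A i0 j0 w|)%R].
Proof.
have [_ idd] := iid.
have mE : measurable [set x : R | M < `|x|] by apply: (measurable_norm_gt (f := id)).
exact: (idd ij (i0, j0) _ mE).
Qed.

(** Either some entry falls in the tail, or the sample lies in one of the finitely
many joint cells of the bad event of the finite model. *)
Lemma transfer (S : set T) (Bad : {ffun 'I_N * 'I_n -> G} -> Prop) (M eps : R) :
  measurable S -> (P [set w | (M < `|A i0 j0 w|)%R] <= eps%:E)%E ->
  (forall w, S w -> (forall i j, `|A i j w| <= M) -> Bad [ffun ij => q (A ij.1 ij.2 w)]) ->
  (P S <= ((N * n)%:R * eps + Pr cell_prob Bad)%:E)%E.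
Proof.
move=> mS tail bad.
pose tl (ij : 'I_N * 'I_n) := [set w | M < `|A ij.1 ij.2 w|].
have mtl ij : measurable (tl ij) by exact: measurable_norm_gt.
pose s := seq.filter (fun f => `[< Bad f >]) (index_enum {ffun 'I_N * 'I_n -> G}).
pose S1 := \big[setU/set0]_(ij <- index_enum ('I_N * 'I_n)%type) tl ij.
pose S2 := \big[setU/set0]_(f <- s) joint_cell f.
have mS1 : measurable S1 by apply: bigsetU_measurable.
have mS2 : measurable S2 by apply: bigsetU_measurable => f _; exact: measurable_joint_cell.
have sub : S `<=` S1 `|` S2.
  move=> w Sw; case: (pselect (exists ij, tl ij w)) => [[ij tw]|nt]; [left|right].
    by rewrite /S1 -bigcup_seq; exists ij => //=; exact: mem_index_enum.
  rewrite /S2 -bigcup_seq; exists [ffun ij => q (A ij.1 ij.2 w)]; last first.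
    by move=> ij _ /=; rewrite ffunE.
  rewrite /= mem_filter mem_index_enum andbT; apply/asboolP/bad => // i j.
  by rewrite leNgt; apply/negP => h; apply: nt; exists (i, j).
apply: le_trans (le_measure P _ _ sub) _; rewrite ?inE //; first exact: measurableU.
apply: le_trans (measureU2 _ mS1 mS2) _; rewrite EFinD; apply: leeD.
  apply: le_trans (measure_bigsetU_le P _ mtl) _.
  apply: (@le_trans _ _ (\sum_(ij : 'I_N * 'I_n) eps%:E)%E).
    by apply: lee_sum => ij _; rewrite /tl tail_prob.
  by rewrite sumEFin lee_fin sumr_const card_prod !card_ord mulr_natl.
apply: le_trans (measure_bigsetU_le P _ measurable_joint_cell) _.
rewrite big_filter (eq_bigr (fun f => (weight cell_prob f)%:E)); last first.
  by move=> f _; exact: joint_cell_prob.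
rewrite sumEFin lee_fin /Pr /Ex big_mkcond; apply: ler_sum => f _.
by case: asboolP; rewrite ?mulr1 ?mulr0.
Qed.

End Discretized.
End Transfer.

(** * The theorem *)

Theorem theorem1 (R : realType) (beta delta : R) (hbeta : 0 < beta)
    (hdelta : 1 < delta) :
  exists (u v : R) (N0 : nat), [/\ 0 < u, 0 < v &
    forall (N n : nat) (N_gt0 : (0 < N)%N) (n_gt0 : (0 < n)%N),
      Num.max N0%:R (delta * n%:R) <= N%:R ->
    forall (d : measure_display) (T : measurableType d) (P : probability T R)
      (A : 'I_N -> 'I_n -> {RV P >-> R}),
      iid_entries A ->
    forall alpha : R, 0 < alpha ->
      (concentration (A (Ordinal N_gt0) (Ordinal n_gt0)) alpha
         <= (1 - beta)%:E)%E ->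
    forall B : 'M[R]_(N, n),
      (P [set w | (smallest_singular (sample_mx A w + B)
                     <= alpha * u * Num.sqrt N%:R)%R]
         <= (expR (- (v * N%:R)))%:E)%E].
Proof.
have b2 : 0 < beta / 2 by lra.
have [u1 [v1 [N1 [u10 v10 H]]]] := discrete_smallest_singular b2 hdelta.
pose u := Num.sqrt (u1 / 64).
have u0 : 0 < u by rewrite sqrtr_gt0; lra.
have u2 : u ^+ 2 = u1 / 64 by rewrite sqr_sqrtr //; lra.
exists u, (v1 / 2), N1; split=> //; first lra.
move=> N n N_gt0 n_gt0; rewrite ge_max => /andP[NN dn] d T P A iid alpha a0 conc B.
rewrite ler_nat in NN.
have Npos : 0 < N%:R :> R by rewrite ltr0n.
have npos : 0 < n%:R :> R by rewrite ltr0n.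
set i0 := Ordinal N_gt0 in conc; set j0 := Ordinal n_gt0 in conc.
(* The tail may have any probability up to this gap: the rate is halved. *)
pose gap := expR (- (v1 / 2 * N%:R)) - expR (- (v1 * N%:R)).
have gap0 : 0 < gap.
  by rewrite subr_gt0 ltr_expR ltrN2 ltr_pM2r //; lra.
pose eps := Num.min (beta / 2) (gap / (N * n)%:R).
have NnR : 0 < (N * n)%:R :> R by rewrite ltr0n muln_gt0 N_gt0.
have eps0 : 0 < eps by rewrite lt_min b2 divr_gt0.
have eps1 : eps <= beta / 2 by rewrite ge_min lexx.
have eps2 : (N * n)%:R * eps <= gap.
  by rewrite mulrC -ler_pdivlMr // ge_min lexx orbT.
have [M tail] := tightness (A i0 j0) eps0.
(* The mesh [alpha * t] must be below [alpha / 2] for the concentration, and of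
   order [alpha / sqrt n] for the error in norm; t^2 <= t saves a root. *)
pose t := Num.min (1 / 2) (u1 / (16 * n%:R)).
have t0 : 0 < t.
  by rewrite lt_min; apply/andP; split; [lra | rewrite divr_gt0 // mulr_gt0].
have t1 : t <= 1 / 2 by rewrite ge_min lexx.
have t2 : t ^+ 2 * n%:R <= u1 / 16.
  have h : t <= u1 / (16 * n%:R) by rewrite ge_min lexx orbT.
  have h' : t * n%:R <= u1 / 16.
    by move: h; rewrite ler_pdivlMr ?mulr_gt0 //; move: (t) => s h; lra.
  have tn : 0 <= t * n%:R by rewrite mulr_ge0 // ltW.
  rewrite expr2 -mulrA; apply: le_trans h'; apply: ler_piMl => //; lra.
pose eta := alpha * t.
have eta0 : 0 < eta by rewrite mulr_gt0.
have [G [q [mq close]]] := fine_discretization M eta0.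
(* A cell is represented by one of its points; empty cells by 0. *)
pose rep (x : G) : R := xget 0 [set a | q a = x].
have qrep a : q (rep (q a)) = q a.
  by rewrite /rep; case: xgetP => [b _ ->|/(_ a)] //=.
have near a : `|a| <= M -> `|a - rep (q a)| <= eta.
  by move=> aM; apply: close => //; rewrite qrep.
pose p := cell_prob A q i0 j0.
(* The entries are rescaled so that the concentration, now at level alpha / 2,
   is taken at radius 1. *)
pose val (x : G) := 2 / alpha * rep x.
pose B' := (2 / alpha) *: B.
have a2 : 0 < 2 / alpha by rewrite divr_gt0.
have pconc la : \sum_(x | `|val x - la| <= 1) p x <= 1 - beta / 2.
  rewrite -lee_fin (cell_prob_sum A mq i0 j0 (fun x => `|val x - la| <= 1)).
  pose c := alpha / 2 * la.
  have mY : measurable [set w | `|A i0 j0 w - c| <= alpha].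
    have -> : [set w | `|A i0 j0 w - c| <= alpha] = A i0 j0 @^-1` `[c - alpha, c + alpha]%classic.
      by apply/seteqP; split => w /=; rewrite in_itv /= ler_distl.
    by apply: measurable_funPTI; exact: measurable_itv.
  have mt : measurable [set w | M < `|A i0 j0 w|] by exact: measurable_norm_gt.
  have mQ x : measurable ((fun w => q (A i0 j0 w)) @^-1` [set x]).
    exact: (measurable_funPTI (A i0 j0) (mq x)).
  apply: (@le_trans _ _ (P ([set w | (`|A i0 j0 w - c| <= alpha)%R] `|`
     [set w | (M < `|A i0 j0 w|)%R]))).
    apply: le_measure; rewrite ?inE.
    - exact: (measurable_discrete mQ (fun x => `|val x - la| <= 1)).
    - exact: measurableU.
    move=> w /= h; have [hM|hM] := leP `|A i0 j0 w| M; [left|by right].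
    have h1 := near _ hM; set a := A i0 j0 w in h h1 *.
    have h2 : `|rep (q a) - c| <= alpha / 2.
      have -> : rep (q a) - c = alpha / 2 * (val (q a) - la).
        by rewrite /val /c; field; rewrite gt_eqF.
      by rewrite normrM gtr0_norm ?divr_gt0 // ler_piMr // divr_ge0 // ltW.
    have -> : a - c = (a - rep (q a)) + (rep (q a) - c) by ring.
    apply: le_trans (ler_normD _ _) _.
    have : eta <= alpha / 2 by rewrite /eta; have := ler_wpM2l (ltW a0) t1; lra.
    by lra.
  apply: le_trans (measureU2 _ mY mt) _.
  have -> : (1 - beta / 2)%:E = ((1 - beta)%:E + (beta / 2)%:E)%E :> \bar R.
    by rewrite -EFinD; congr EFin; field.
  apply: leeD; first exact: le_trans (concentration_ge (A i0 j0) alpha c) conc.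
  by apply: le_trans tail _; rewrite lee_fin.
have fin := H N n NN dn G p val (cell_prob_ge0 A q i0 j0) (cell_prob_sum1 A mq i0 j0) pconc B'.
have sN : 0 <= alpha * u * Num.sqrt N%:R.
  by rewrite !mulr_ge0 ?sqrtr_ge0 // ltW.
apply: (@le_trans _ _ ((N * n)%:R * eps + Pr p (fun f => exists y, 0 < nsq y /\
    nsq (shifted val B' f *m y) <= u1 * N%:R * nsq y))%:E); last first.
  by rewrite lee_fin; have := lerD eps2 fin; rewrite /gap subrK.
apply: (transfer iid mq _ tail).
  apply: measurable_smallest_singular => // i j.
  under eq_fun do rewrite !mxE.
  by apply: measurable_funD => //; exact: measurable_cst.
move=> w /= hs hM; set D := sample_mx A w + B in hs.
have [|y y1 hy] := smallest_singular_near_min (c' := 2 * (alpha * u * Num.sqrt N%:R)) n_gt0 sN hs.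
  by have : 0 < alpha * u * Num.sqrt N%:R; [rewrite !mulr_gt0 // sqrtr_gt0 | lra].
exists y; rewrite y1; split; first exact: ltr01.
rewrite mulr1.
pose De : 'M[R]_(N, n) := \matrix_(i, j) (rep (q (A i j w)) - A i j w).
have -> : shifted val B' [ffun ij => q (A ij.1 ij.2 w)] = (2 / alpha) *: (D + De).
  by apply/matrixP => i j; rewrite !mxE ffunE /val /=; ring.
rewrite -scalemxAl mulmxDl nsqZ.
have f1 : frob De <= N%:R * (n%:R * eta ^+ 2).
  apply: (@le_trans _ _ (\sum_(i < N) \sum_(j < n) eta ^+ 2)).
    apply: ler_sum => i _; apply: ler_sum => j _; rewrite mxE.
    rewrite -real_normK ?num_real // distrC.
    by rewrite ler_sqr ?nnegrE ?(ltW eta0) // near.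
  by rewrite !sumr_const !card_ord -[leLHS]mulr_natl -[(eta ^+ 2) *+ n]mulr_natl.
have f2 := nsq_mul_le De y; rewrite y1 mulr1 in f2.
have f3 := nsqD_le (D *m y) (De *m y).
have f4 : nsq (D *m y + De *m y) <= 2 * (2 * (alpha * u * Num.sqrt N%:R)) ^+ 2 +
   2 * (N%:R * (n%:R * eta ^+ 2)) by lra.
apply: le_trans (ler_wpM2l (sqr_ge0 _) f4) _.
have -> : (2 / alpha) ^+ 2 * (2 * (2 * (alpha * u * Num.sqrt N%:R)) ^+ 2 +
    2 * (N%:R * (n%:R * eta ^+ 2))) = 32 * u ^+ 2 * Num.sqrt N%:R ^+ 2 + 8 * N%:R * (t ^+ 2 * n%:R).
  by rewrite /eta; field; rewrite gt_eqF.
rewrite u2 sqr_sqrtr ?ler0n //.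
have : 8 * N%:R * (t ^+ 2 * n%:R) <= 8 * N%:R * (u1 / 16).
  by apply: ler_wpM2l => //; rewrite mulr_ge0.
by lra.
Qed.
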